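(* Let $\mathcal{M}$ be a strongly connected MDP with $\mathbb{E}^{\max}_{\mathcal{M}}(\mathrm{MP})=0$. Then (a) $\mathcal{M}$ contains a 0-EC iff $\mathcal{M}$ has a scheduler under which, from some state, the set of infinite paths that are bounded from below has positive probability, iff $\mathcal{M}$ has a scheduler that is bounded from below; (b) $\mathcal{M}$ has no 0-EC iff each scheduler for $\mathcal{M}$ is negatively weight-divergent.
   Context: An MDP $\mathcal{M}=(S,\mathit{Act},P,\mathit{wgt})$ has finite state and action sets, rational transition probabilities and integer weights on state-action pairs; paths, path weights, schedulers and measures $\Pr^{\mathfrak{S}}_{\mathcal{M},s}$ are standard. End components are strongly connected sub-MDPs closed under successors; $\mathcal{M}$ is strongly connected if it is an end component; a 0-EC is an end component all of whose cycles have weight 0. $\mathrm{MP}(\varsigma)=\limsup_n\mathit{wgt}(\varsigma[n])/n$, $\mathbb{E}^{\max}_{\mathcal{M}}(\mathrm{MP})$ the maximal expected mean payoff. An infinite path $\varsigma$ is bounded from below if $\liminf_n\mathit{wgt}(\varsigma[n])\in\mathbb{Z}$, and negatively weight-divergent if $\liminf_n\mathit{wgt}(\varsigma[n])=-\infty$. A scheduler is bounded from below (resp. negatively weight-divergent) if from every state almost all of its infinite paths are bounded from below (resp. negatively weight-divergent). *)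

(* Defs.v *)
From HB Require Import structures.
From mathcomp Require Import all_boot all_order all_algebra.
From mathcomp Require Import all_classical all_reals all_analysis.

Set Implicit Arguments.
Unset Strict Implicit.
Unset Printing Implicit Defensive.

Import Order.TTheory GRing.Theory Num.Theory.
Import numFieldNormedType.Exports.

Local Open Scope classical_set_scope.
Local Open Scope ring_scope.

(* Every state has an enabled action ([mdp_no_trap]), so that all maximal paths
   are infinite. A state without enabled actions cannot belong to an end
   component, so strongly connected MDPs satisfy this in any case. *)
Record mdp := MDP {
  state : finType;
  action : finType;
  prob : state -> action -> state -> rat;
  wgt : state -> action -> int;
  mdp_state_neq0 : (0 < #|state|)%N;
  mdp_prob_ge0 : forall s a t, 0 <= prob s a t;
  mdp_prob_sum : forall s a,
    \sum_t prob s a t = 0 \/ \sum_t prob s a t = 1;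
  mdp_no_trap : forall s, [exists a, \sum_t prob s a t == 1] }.

Arguments prob {_} _ _ _.
Arguments wgt {_} _ _.

Definition enabled (M : mdp) (s : state M) : {set action M} :=
  [set a | \sum_t prob s a t == 1].

(* A sub-MDP is given by a set [T] of states and the actions [A s] retained in
   each [s \in T]; the values of [A] outside [T] are irrelevant. *)
Definition sub_mdp (M : mdp) (T : {set state M})
    (A : state M -> {set action M}) : Prop :=
  T != finset.set0 /\
  (forall s, s \in T ->
    [/\ A s != finset.set0, A s \subset enabled s &
        forall a, a \in A s -> forall t, 0 < prob s a t -> t \in T]).

Definition sub_edge (M : mdp) (T : {set state M})
    (A : state M -> {set action M}) : rel (state M) :=
  fun s t => (s \in T) && [exists a in A s, 0 < prob s a t].

Definition end_component (M : mdp) (T : {set state M})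
    (A : state M -> {set action M}) : Prop :=
  sub_mdp T A /\
  (forall s t, s \in T -> t \in T -> connect (sub_edge T A) s t).

Definition strongly_connected (M : mdp) : Prop :=
  end_component [set: state M]%SET (@enabled M).

(* The cycle s_0 a_0 s_1 a_1 ... s_k a_k s_0 is the sequence of its pairs
   (s_i, a_i). *)
Definition sub_cycle (M : mdp) (T : {set state M})
    (A : state M -> {set action M}) (c : seq (state M * action M)) : bool :=
  all (fun x => (x.1 \in T) && (x.2 \in A x.1)) c &&
  cycle (fun x y => 0 < prob x.1 x.2 y.1) c.

Definition zero_end_component (M : mdp) (T : {set state M})
    (A : state M -> {set action M}) : Prop :=
  end_component T A /\
  (forall c, sub_cycle T A c -> \sum_(x <- c) wgt x.1 x.2 = 0).

Definition contains_0EC (M : mdp) : Prop :=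
  exists (T : {set state M}) (A : state M -> {set action M}),
    zero_end_component T A.

(* [rho] encodes s_0 a_0 s_1 a_1 ... as [rho i = (s_i, a_i)]. The type also
   contains sequences that are not paths of [M]; they form a null set for the
   path measures below. *)
Definition ipath (M : mdp) : Type := nat -> state M * action M.

Lemma ipath_inhabited (M : mdp) : inhabited (ipath M).
Proof.
have [s _|s0] := pickP (state M); last first.
  by have := mdp_state_neq0 M; rewrite eq_card0.
have /existsP[a _] := mdp_no_trap s.
exact: (inhabits (fun=> (s, a))).
Qed.

HB.instance Definition _ (M : mdp) := gen_eqMixin (ipath M).
HB.instance Definition _ (M : mdp) := gen_choiceMixin (ipath M).
HB.instance Definition _ (M : mdp) :=
  isPointed.Build (ipath M) (inhabited_witness (ipath_inhabited M)).

Definition ipath_cylinder (M : mdp) (h : seq (state M * action M)) :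
  set (ipath M) := [set rho | mkseq rho (size h) = h].

Definition ipath_cylinders (M : mdp) : set (set (ipath M)) :=
  range (@ipath_cylinder M).

(* [ipath M] carries the sigma-algebra generated by the cylinder sets. *)
HB.instance Definition _ (M : mdp) :=
  Measurable.copy (ipath M) (g_sigma_algebraType (@ipath_cylinders M)).

(* wgt(rho[n]), where rho[n] is the prefix s_0 a_0 ... s_(n-1) a_(n-1) s_n. *)
Definition pwgt (M : mdp) (rho : ipath M) (n : nat) : int :=
  \sum_(i < n) wgt (rho i).1 (rho i).2.

Definition mean_payoff (R : realType) (M : mdp) (rho : ipath M) : \bar R :=
  limn_esup (fun n => ((pwgt rho n)%:~R / n%:R)%:E).

Definition liminf_wgt (R : realType) (M : mdp) (rho : ipath M) : \bar R :=
  limn_einf (fun n => ((pwgt rho n)%:~R)%:E).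

Definition bounded_below (R : realType) (M : mdp) (rho : ipath M) : Prop :=
  exists z : int, liminf_wgt R rho = (z%:~R)%:E.

Definition neg_divergent (R : realType) (M : mdp) (rho : ipath M) : Prop :=
  liminf_wgt R rho = -oo%E.

(* Randomized and history-dependent: [sched h s] is the distribution on actions
   chosen after the finite path s_0 a_0 ... s_(n-1) a_(n-1) s, where
   [h = [:: (s_0, a_0); ...; (s_(n-1), a_(n-1))]]. *)
Record scheduler (R : realType) (M : mdp) := Scheduler {
  sched :> seq (state M * action M) -> state M -> action M -> R;
  sched_ge0 : forall h s a, 0 <= sched h s a;
  sched_sum : forall h s, \sum_a sched h s a = 1;
  sched_enabled : forall h s a, a \notin enabled s -> sched h s a = 0 }.

(* The probability that the next pair is [x] = (state reached, action chosen)
   after the history [h]; the initial state is [s]. *)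
Definition step_prob (R : realType) (M : mdp) (sg : scheduler R M)
    (s : state M) (h : seq (state M * action M)) (x : state M * action M) : R :=
  (if h is y :: h' then let z := last y h' in ratr (prob z.1 z.2 x.1)
   else (x.1 == s)%:R) * sg h x.1 x.2.

(* The product of the probabilities [k] of the successive entries of [h], given
   the entries [acc] already seen. *)
Fixpoint cyl_prob (R : realType) (X : Type) (k : seq X -> X -> R)
    (acc h : seq X) : R :=
  if h is x :: h' then k acc x * cyl_prob k (rcons acc x) h' else 1.

(* A random sequence with prescribed transition probabilities [k] is sampled
   from a uniform point of [0, 1[ by iterated subdivision of intervals. *)

Section sampling.
Variables (R : realType) (X : finType) (x0 : X) (k : seq X -> X -> R).

Let cum (acc : seq X) (i : nat) : R :=
  \sum_(0 <= j < i) k acc (nth x0 (enum X) j).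

Let draw (acc : seq X) (u : R) : X :=
  nth x0 (enum X) (find (fun i => u < cum acc i.+1) (iota 0 #|X|)).

Let rest (acc : seq X) (u : R) : R :=
  let x := draw acc u in (u - cum acc (index x (enum X))) / k acc x.

Fixpoint sample (acc : seq X) (u : R) (n : nat) : X :=
  if n is n'.+1 then sample (rcons acc (draw acc u)) (rest acc u) n'
  else draw acc u.

Hypothesis k_ge0 : forall h x, 0 <= k h x.

Let cum_le acc i j : (i <= j)%N -> cum acc i <= cum acc j.
Proof.
move=> ij; rewrite /cum (big_cat_nat _ ij)//= lerDl.
by apply: sumr_ge0 => *; exact: k_ge0.
Qed.

Let cum_full acc : cum acc #|X| = \sum_x k acc x.
Proof. by rewrite /cum cardE -big_enum/= (big_nth x0). Qed.

Let cumS acc (x : X) :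
  cum acc (index x (enum X)).+1 = cum acc (index x (enum X)) + k acc x.
Proof. by rewrite /cum big_nat_recr//= nth_index// mem_enum. Qed.

Let drawE acc u x : \sum_y k acc y = 1 -> 0 <= u < 1 ->
  (draw acc u == x) =
  (cum acc (index x (enum X)) <= u < cum acc (index x (enum X)) + k acc x).
Proof.
move=> k1 /andP[u0 u1]; rewrite -cumS.
set p := (fun i => u < cum acc i.+1).
have X0 : (0 < #|X|)%N by apply/card_gt0P; exists x0.
have hp : has p (iota 0 #|X|).
  apply/hasP; exists #|X|.-1; first by rewrite mem_iota/= add0n ltn_predL.
  by rewrite /p prednK// cum_full k1.
have fX : (find p (iota 0 #|X|) < #|X|)%N.
  by move: hp; rewrite has_find size_iota.
have h1 : u < cum acc (find p (iota 0 #|X|)).+1.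
  by have := nth_find 0%N hp; rewrite nth_iota.
have h2 : cum acc (find p (iota 0 #|X|)) <= u.
  case E : (find p (iota 0 #|X|)) => [|j]; first by rewrite /cum big_nil.
  have jf : (j < find p (iota 0 #|X|))%N by rewrite E.
  have := before_find 0%N jf; rewrite nth_iota ?(ltn_trans jf)// add0n.
  by rewrite /p => /negbT; rewrite -leNgt.
rewrite /draw -/p; set f := find _ _ in fX h1 h2 *.
apply/eqP/idP => [<-|/andP[a b]].
  by rewrite index_uniq -?cardE ?enum_uniq// h1 h2.
have xf : f = index x (enum X).
  apply/eqP; rewrite eqn_leq; apply/andP; split; rewrite leqNgt; apply/negP => l.
    by have := lt_le_trans b (le_trans (cum_le acc l) h2); rewrite ltxx.
  by have := lt_le_trans h1 (le_trans (cum_le acc l) a); rewrite ltxx.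
by rewrite xf nth_index// mem_enum.
Qed.

Hypothesis k_sum : forall h, cyl_prob k [::] h != 0 -> \sum_x k h x = 1.

Lemma cyl_prob_ge0 acc h : 0 <= cyl_prob k acc h.
Proof. by elim: h acc => //= x h ih acc; rewrite mulr_ge0. Qed.

Lemma cyl_prob_rcons acc h x :
  cyl_prob k acc (rcons h x) = cyl_prob k acc h * k (acc ++ h) x.
Proof.
elim: h acc => [|y h ih] acc /=; first by rewrite cats0 mul1r mulr1.
by rewrite ih mulrA cat_rcons.
Qed.

Let mkseqS (T : Type) (f : nat -> T) n :
  mkseq f n.+1 = f 0%N :: mkseq (fun i => f i.+1) n.
Proof. by rewrite /mkseq/= (iotaDl 1 0 n) -map_comp. Qed.

Lemma sample_cylinder h acc : cyl_prob k [::] acc != 0 ->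
  exists a, [/\ 0 <= a, a + cyl_prob k acc h <= 1 &
    forall u, 0 <= u < 1 ->
      (mkseq (sample acc u) (size h) == h) = (a <= u < a + cyl_prob k acc h)].
Proof.
elim: h acc => [|x h ih] acc acc0.
  by exists 0; split; rewrite /= ?add0r// => u ->; rewrite eqxx.
set c := cum acc (index x (enum X)).
have c0 : 0 <= c by apply: sumr_ge0 => *; exact: k_ge0.
have ck1 : c + k acc x <= 1.
  rewrite /c -cumS -(k_sum acc0) -cum_full; apply: cum_le.
  by rewrite cardE index_mem mem_enum.
have [kx0|kx0] := eqVneq (k acc x) 0.
  exists 0; rewrite /= kx0 mul0r addr0; split => // u u01.
  rewrite mkseqS eqseq_cons /= drawE ?k_sum// kx0 addr0.
  by case: (leP c u) => //= _; rewrite ?andbF ltNge; case: (0 <= u).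
have kx : 0 < k acc x by rewrite lt_neqAle eq_sym kx0 k_ge0.
have [|a [a0 a1 ha]] := ih (rcons acc x).
  by rewrite cyl_prob_rcons mulf_neq0.
set W := cyl_prob k (rcons acc x) h in a1 ha *.
have W0 : 0 <= W by exact: cyl_prob_ge0.
exists (c + k acc x * a); rewrite /= -/W; split.
- by rewrite addr_ge0// mulr_ge0// ltW.
- rewrite -addrA -mulrDr (le_trans _ ck1)// lerD2l.
  by rewrite -[leRHS]mulr1 ler_wpM2l// ltW.
move=> u u01; rewrite mkseqS eqseq_cons /=.
have [E|E] := eqVneq (draw acc u) x.
  rewrite {1}/rest E /= -/c.
  have := drawE x (k_sum acc0) u01; rewrite E eqxx -/c => /esym/andP[cu uck].
  rewrite ha; last first.
    by rewrite divr_ge0 ?subr_ge0//= ltr_pdivrMr// mul1r ltrBlDl.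
  rewrite ler_pdivlMr// ltr_pdivrMr// lerBrDl ltrBlDl.
  by rewrite [a * _]mulrC [(a + W) * _]mulrC mulrDr addrA.
have := drawE x (k_sum acc0) u01; rewrite (negbTE E) -/c /= => /esym/negbT H.
apply/esym; apply: contraNF H => /andP[l1 l2].
rewrite (le_trans _ l1) ?lerDl ?mulr_ge0//= (lt_le_trans l2)//.
by rewrite -addrA -mulrDr lerD2l -[leRHS]mulr1 ler_wpM2l.
Qed.

End sampling.

Section path_measure.
Variables (R : realType) (M : mdp) (sg : scheduler R M) (s : state M).

Let k := step_prob sg s.

Lemma step_prob_ge0 h x : 0 <= k h x.
Proof.
rewrite /k /step_prob mulr_ge0 ?sched_ge0//.
by case: h => [|y h]; rewrite ?ler0n// ler0q mdp_prob_ge0.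
Qed.

Lemma step_prob_sum h : cyl_prob k [::] h != 0 -> \sum_x k h x = 1.
Proof.
move=> h0; rewrite -(pair_bigA _ (fun t a => k h (t, a)))/= /k /step_prob/=.
under eq_bigr do rewrite -mulr_sumr sched_sum mulr1.
case: h h0 => [_|y h].
  by rewrite (bigD1 s)//= eqxx big1 ?addr0// => t /negbTE ->.
rewrite lastI cyl_prob_rcons /= mulf_eq0 negb_or => /andP[_].
set z := last y h => zn.
have : z.2 \in enabled z.1.
  apply: contraNT zn => zn.
  by rewrite /k /step_prob sched_enabled// mulr0.
by rewrite inE => /eqP e; rewrite -rmorph_sum /= e rmorph1.
Qed.

Let unit_itv : set (measurableTypeR R) := `[0, 1[.

Let mD : measurable unit_itv.
Proof. exact: measurable_itv. Qed.

Let draw_path (u : measurableTypeR R) : ipath M :=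
  if (u : R) \in `[0, 1[ then (sample ((point : ipath M) 0%N) k [::] u : ipath M)
  else (point : ipath M).

Let draw_path_cylinder h : exists2 a, 0 <= a &
  unit_itv `&` draw_path @^-1` ipath_cylinder h =
  `[a, a + cyl_prob k [::] h[%classic.
Proof.
have [|a [a0 a1 ha]] :=
  sample_cylinder ((point : ipath M) 0%N) step_prob_ge0 step_prob_sum h (acc := [::]).
  by rewrite /= oner_neq0.
exists a => //; apply/seteqP; split => u /=; rewrite /unit_itv /draw_path /=.
  move=> [u01]; rewrite u01 /ipath_cylinder/= => /eqP.
  by rewrite ha -?in_itv//= in_itv/=.
rewrite in_itv/= => uI.
have u01 : 0 <= u < 1.
  by move: uI => /andP[? ?]; rewrite (le_trans a0)//= (lt_le_trans _ a1).
by rewrite in_itv/= u01; split => //; apply/eqP; rewrite ha.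
Qed.

Let measurable_draw_path : measurable_fun setT draw_path.
Proof.
apply: (measurability (@ipath_cylinders M)) => //.
move=> _ [_ [h _ <-] <-]; rewrite setTI.
have [a _ e] := draw_path_cylinder h.
rewrite -[X in measurable X](setIT) -(setUv unit_itv) setIUr; apply: measurableU.
  by rewrite setIC e; exact: measurable_itv.
have [p|np] := pselect (ipath_cylinder h (point : ipath M)).
  rewrite (_ : _ `&` _ = ~` unit_itv); first exact: measurableC.
  apply/seteqP; split => [u []//|u nu]; split => //=.
  by move: nu; rewrite /draw_path /unit_itv /=; case: ifP.
rewrite (_ : _ `&` _ = set0); first exact: measurable0.
apply/seteqP; split => // u /= [].
by rewrite /draw_path /unit_itv /=; case: ifP.
Qed.

Let mu0 := pushforward (mrestr (@lebesgue_measure R) mD) draw_path.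
Let mu0_0 : mu0 set0 = 0%E.
Proof. by rewrite /mu0 /pushforward preimage_set0 measure0. Qed.

Let mu0_ge0 A : (0 <= mu0 A)%E.
Proof. exact: measure_ge0. Qed.

Let mu0_sigma_additive : semi_sigma_additive mu0.
Proof.
have mf A : measurable A -> measurable (draw_path @^-1` A).
  by move=> mA; rewrite -[X in measurable X]setTI; exact: measurable_draw_path.
move=> F mF tF mUF; rewrite /mu0 /pushforward preimage_bigcup.
apply: measure_semi_sigma_additive.
- by move=> n; exact: mf.
- apply/trivIsetP => /= i j _ _ ij; rewrite -preimage_setI.
  by move/trivIsetP : tF => /(_ _ _ _ _ ij) ->//; rewrite preimage_set0.
- by rewrite -preimage_bigcup; exact: mf.
Qed.

HB.instance Definition _ :=
  isMeasure.Build _ _ _ mu0 mu0_0 mu0_ge0 mu0_sigma_additive.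

Let mu0_cylinder h :
  mu0 (ipath_cylinder h) = (cyl_prob k [::] h)%:E.
Proof.
rewrite /mu0 /pushforward /mrestr setIC.
have [a _ ->] := draw_path_cylinder h.
rewrite lebesgue_measure_itv/= lte_fin ltrDl.
have := cyl_prob_ge0 step_prob_ge0 [::] h; rewrite le_eqVlt => /predU1P[<-|w0].
  by rewrite ltxx.
by rewrite w0 -EFinB addrAC subrr add0r.
Qed.

Let mu0_setT : mu0 setT = 1%E.
Proof.
rewrite -(mu0_cylinder [::]); congr (mu0 _).
by apply/seteqP; split.
Qed.

HB.instance Definition _ := Measure_isProbability.Build _ _ _ mu0 mu0_setT.

Lemma path_measure_exists : exists mu : probability (ipath M) R,
  forall h, mu (ipath_cylinder h) = (cyl_prob (step_prob sg s) [::] h)%:E.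
Proof. by exists mu0; exact: mu0_cylinder. Qed.

(* The cylinder sets form a pi-system (up to the empty set) generating the
   sigma-algebra, so [path_measure_cylinder] determines the measure. *)
Definition path_measure : probability (ipath M) R :=
  sval (cid path_measure_exists).

Lemma path_measure_cylinder h : path_measure (ipath_cylinder h) =
  (cyl_prob (step_prob sg s) [::] h)%:E.
Proof. exact: (svalP (cid path_measure_exists)). Qed.

End path_measure.

Definition expected_MP (R : realType) (M : mdp) (sg : scheduler R M)
    (s : state M) : \bar R :=
  (\int[path_measure sg s]_rho mean_payoff R rho)%E.

(* The maximal expected mean payoff from [s]; it does not depend on [s] when [M]
   is strongly connected. *)
Definition Emax_MP (R : realType) (M : mdp) (s : state M) : \bar R :=
  ereal_sup [set expected_MP sg s | sg in [set: scheduler R M]].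

Definition sched_bounded_below (R : realType) (M : mdp) (sg : scheduler R M) :
    Prop :=
  forall s, {ae path_measure sg s, forall rho, bounded_below R rho}.

Definition sched_neg_divergent (R : realType) (M : mdp) (sg : scheduler R M) :
    Prop :=
  forall s, {ae path_measure sg s, forall rho, neg_divergent R rho}.

(* Main.v *)
(** The value functions of the discounted problems, centred at a fixed state,
    stay bounded as the discount factor tends to 1, by strong connectivity.
    A limit point [(g, h)] satisfies
    [g + h s = max_a (w s a + sum_t P s a t * h t)]. A policy attaining the
    maximum has mean payoff at least [g] (Fatou), so [g <= 0], and for
    [u = h + const] the process [W_n + u (S_n)] is a supermartingale.
    If there is no 0-EC, then from every state a bounded number of steps leads
    with positive probability to an action that changes [W_n + u (S_n)] with
    positive probability: otherwise the actions leaving it unchanged would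
    contain an end component, whose cycles have weight 0 by telescoping.
    Hence, for [L] large, a strictly concave function of [W_n + u (S_n)],
    corrected by a function of the state, decreases in expectation by a fixed
    amount as long as the process stays in a strip [0, L[, and the process
    almost surely does not stay above any fixed bound.
    Conversely, in a 0-EC the weight of a path depends only on its end points,
    so it suffices to reach the 0-EC and to stay there. *)

Require Import Defs.
From HB Require Import structures.
From mathcomp Require Import all_boot all_order all_algebra.
From mathcomp Require Import all_classical all_reals all_analysis.
From mathcomp Require Import measurable_realfun.
From mathcomp Require Import ring lra zify.

Set Implicit Arguments.
Unset Strict Implicit.
Unset Printing Implicit Defensive.

Import Order.TTheory GRing.Theory Num.Theory.
Import numFieldNormedType.Exports.

Local Open Scope classical_set_scope.
Local Open Scope ring_scope.

(** * Path measures on finite prefixes *)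

Lemma big_tuple_nil (R : nmodType) (X : finType) (G : seq X -> R) :
  \sum_(h : 0.-tuple X) G h = G [::].
Proof. by rewrite (big_pred1 [tuple])// => h; apply/esym/eqP; exact: tuple0. Qed.

Lemma big_tuple_cons (R : nmodType) (X : finType) n (G : seq X -> R) :
  \sum_(h : n.+1.-tuple X) G h = \sum_x \sum_(h : n.-tuple X) G (x :: h).
Proof.
rewrite (pair_bigA _ (fun x (h : n.-tuple X) => G (x :: h)))/=.
rewrite (reindex (fun p : X * n.-tuple X => [tuple of p.1 :: p.2]))//=.
exists (fun h : n.+1.-tuple X => (thead h, [tuple of behead h])) => [[x h] _|h _] /=.
  by congr (_, _); apply/val_inj.
by rewrite -tuple_eta.
Qed.

Lemma big_pair (R : nmodType) (I J : finType) (G : I * J -> R) :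
  \sum_x G x = \sum_i \sum_j G (i, j).
Proof.
by rewrite (pair_bigA _ (fun i j => G (i, j)))/=; apply: eq_bigr => -[].
Qed.

Lemma tuple_mkseq (T : Type) (f : nat -> T) n :
  exists h : n.-tuple T, tval h = mkseq f n.
Proof.
have sz : size (mkseq f n) == n by rewrite size_mkseq.
by exists (Tuple sz).
Qed.

Section cylinder_measure.
Variables (R : realType) (M : mdp).
Implicit Types (rho : ipath M) (n : nat).

Lemma measurable_cylinder h : measurable (@ipath_cylinder M h).
Proof. by apply: sub_sigma_algebra; exists h. Qed.

(** Only finitely many histories have length [n], so an event about the first [n] pairs is a finite
    union of cylinders, hence measurable. *)
Lemma mkseq_setE n (D : set (seq (state M * action M))) :
  [set rho : ipath M | D (mkseq rho n)] =
  \bigcup_(h in [set h : n.-tuple (state M * action M) | D h]) ipath_cylinder h.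
Proof.
apply/seteqP; split => rho /=.
  have [h hE] := tuple_mkseq rho n; rewrite -hE => Dh; exists h => //.
  by rewrite /ipath_cylinder/= size_tuple.
by move=> [h Dh]; rewrite /ipath_cylinder/= size_tuple => ->.
Qed.

Lemma measurable_mkseq n (D : set (seq (state M * action M))) :
  measurable [set rho : ipath M | D (mkseq rho n)].
Proof.
rewrite mkseq_setE; apply: fin_bigcup_measurable.
  exact: finite_finset.
by move=> h _; exact: measurable_cylinder.
Qed.

Lemma measurable_fun_mkseq d (T : sigmaRingType d) n
    (g : seq (state M * action M) -> T) :
  measurable_fun setT (fun rho : ipath M => g (mkseq rho n)).
Proof.
by move=> _ Y mY; rewrite setTI; exact: (@measurable_mkseq n (g @^-1` Y)).
Qed.

Variables (sg : scheduler R M) (s : state M).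

(** The integrand is a finite combination of indicators of cylinders; nonnegativity makes the
    integral linear on it without integrability conditions. *)
Lemma integral_mkseq n (g : seq (state M * action M) -> R) :
  (forall h, size h = n -> 0 <= g h) ->
  (\int[path_measure sg s]_rho (g (mkseq rho n))%:E)%E =
  (\sum_(h : n.-tuple (state M * action M))
     cyl_prob (step_prob sg s) [::] h * g h)%:E.
Proof.
move=> g0.
under eq_integral => rho _.
  have -> : (g (mkseq rho n))%:E =
    (\sum_(h : n.-tuple (state M * action M))
      (g h)%:E * (\1_(ipath_cylinder h) rho)%:E)%E.
    have [h0 h0E] := tuple_mkseq rho n.
    rewrite (bigD1 h0)//= big1 ?adde0 => [|h hh0].
      rewrite indicE mem_set ?mule1 ?h0E//.
      by rewrite /ipath_cylinder/= size_tuple.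
    rewrite indicE memNset ?mule0// /ipath_cylinder/= size_tuple => e.
    by move/eqP: hh0; apply; apply/val_inj; rewrite /= h0E.
  over.
rewrite ge0_integral_sum//=; last 2 first.
- move=> h; apply: measurable_funeM; apply/measurable_EFinP.
  exact: measurable_indic (measurable_cylinder _).
- by move=> h rho _; rewrite mule_ge0 ?lee_fin// g0// size_tuple.
rewrite -sumEFin; apply: eq_bigr => h _.
rewrite ge0_integralZl//=; last 2 first.
- by apply/measurable_EFinP; exact: measurable_indic (measurable_cylinder _).
- by rewrite lee_fin g0// size_tuple.
rewrite integral_indic//=; last exact: measurable_cylinder.
by rewrite setIT path_measure_cylinder muleC.
Qed.

End cylinder_measure.

(** * Expectations over a finite horizon *)

Section finite_horizon.
Variables (R : realType) (M : mdp) (sg : scheduler R M).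
Implicit Types (s t : state M) (acc h : seq (state M * action M)) (n : nat).

Lemma sum_prob s (a : action M) : a \in enabled s ->
  \sum_t ratr (prob s a t) = 1 :> R.
Proof. by rewrite inE => /eqP e; rewrite -rmorph_sum e rmorph1. Qed.

Lemma prob_ge0 s (a : action M) t : 0 <= ratr (prob s a t) :> R.
Proof. by rewrite ler0q mdp_prob_ge0. Qed.

Lemma sched_neq0 h s a : sg h s a != 0 -> a \in enabled s.
Proof. by apply: contraNT => /sched_enabled ->. Qed.

Lemma sched_mean_le h s (G : action M -> R) b :
  (forall a, sg h s a != 0 -> G a <= b) -> \sum_a sg h s a * G a <= b.
Proof.
move=> Gb; rewrite -[leRHS]mul1r -[X in _ <= X * _](sched_sum sg h s) mulr_suml.
apply: ler_sum => a _; have [->|a0] := eqVneq (sg h s a) 0; first by rewrite !mul0r.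
by rewrite ler_wpM2l ?sched_ge0// Gb.
Qed.

(* The expected value of [g] on the history of length [size acc + n] when the
   history [acc] has led to the state [s]. *)
Fixpoint hexp n acc s (g : seq (state M * action M) -> R) : R :=
  if n is n'.+1 then
    \sum_a sg acc s a *
      \sum_t ratr (prob s a t) * hexp n' (rcons acc (s, a)) t g
  else g acc.

(** [cyl_prob] draws a state and then an action at each step, whereas [hexp] draws an action and
    then a state. The two recursions are half a step apart, hence the sum over [t]. At [n = 0] that
    sum must be 1, which needs the last action to be enabled. *)
Lemma sum_cyl_prob_cons s n y acc g :
  let z := last y acc in z.2 \in enabled z.1 ->
  \sum_(h : n.-tuple (state M * action M))
    cyl_prob (step_prob sg s) (y :: acc) h * g ((y :: acc) ++ h) =
  \sum_t ratr (prob z.1 z.2 t) * hexp n (y :: acc) t g.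
Proof.
elim: n acc => [|n ih] acc z ez.
  rewrite (big_tuple_nil (fun h => cyl_prob _ _ h * g (_ ++ h))).
  by rewrite /= mul1r cats0 -mulr_suml sum_prob// mul1r.
rewrite (big_tuple_cons _ (fun h => cyl_prob _ _ h * g (_ ++ h))).
rewrite big_pair/=.
apply: eq_bigr => t _; rewrite mulr_sumr; apply: eq_bigr => a _.
rewrite {1}/step_prob/= -/z.
under eq_bigr do rewrite -mulrA.
rewrite -mulr_sumr.
have [->|a0] := eqVneq (sg (y :: acc) t a) 0; first by rewrite !(mulr0, mul0r).
rewrite -[LHS]mulrA; congr (_ * _); congr (_ * _).
have := ih (rcons acc (t, a)); rewrite last_rcons/= => <-; last exact: sched_neq0 a0.
by apply: eq_bigr => h _; rewrite cat_rcons.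
Qed.

Lemma sum_cyl_prob_nil s n (g : seq (state M * action M) -> R) :
  \sum_(h : n.-tuple (state M * action M))
    cyl_prob (step_prob sg s) [::] h * g h = hexp n [::] s g.
Proof.
case: n => [|n].
  by rewrite (big_tuple_nil (fun h => cyl_prob _ _ h * g h))/= mul1r.
rewrite (big_tuple_cons _ (fun h => cyl_prob _ _ h * g h)).
rewrite big_pair/=.
rewrite (bigD1 s)//= [X in _ + X]big1 ?addr0 => [|t /negbTE ts]; last first.
  rewrite big1// => a _; rewrite big1// => h _.
  by rewrite /step_prob/= ts !mul0r.
apply: eq_bigr => a _.
rewrite {1}/step_prob/= eqxx mul1r.
under eq_bigr do rewrite -mulrA.
rewrite -mulr_sumr.
have [->|a0] := eqVneq (sg [::] s a) 0; first by rewrite !mul0r.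
congr (_ * _); apply: (@sum_cyl_prob_cons s n (s, a) [::] g).
exact: sched_neq0 a0.
Qed.

Lemma integral_hexp s n (g : seq (state M * action M) -> R) :
  (forall h, size h = n -> 0 <= g h) ->
  (\int[path_measure sg s]_rho (g (mkseq rho n))%:E)%E = (hexp n [::] s g)%:E.
Proof. by move=> g0; rewrite integral_mkseq// sum_cyl_prob_nil. Qed.

Lemma path_measure_mkseq s n (ok : pred (seq (state M * action M))) :
  path_measure sg s [set rho | ok (mkseq rho n)] =
  (hexp n [::] s (fun h => (ok h)%:R))%:E.
Proof.
rewrite -integral_hexp => [|h _]; last exact: ler0n.
have mo := @measurable_mkseq M n ok.
have := integral_indic (path_measure sg s) measurableT mo.
rewrite setIT => <-; apply: eq_integral => rho _.
rewrite indicE; congr ((_ : bool)%:R)%:E.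
by apply/idP/idP => [/set_mem|/mem_set].
Qed.

Lemma hexp_le1 n acc s (ok : pred (seq (state M * action M))) :
  hexp n acc s (fun h => (ok h)%:R) <= 1.
Proof.
elim: n acc s => [|n ih] acc s /=; first by case: (ok acc).
apply: sched_mean_le => a a0.
rewrite -[leRHS](sum_prob (sched_neq0 a0)); apply: ler_sum => t _.
by rewrite -[leRHS]mulr1 ler_wpM2l ?prob_ge0.
Qed.

Lemma hexp_eq0 n acc s (ok : pred (seq (state M * action M))) :
  (forall h x, ok (rcons h x) -> ok h) -> ~~ ok acc ->
  hexp n acc s (fun h => (ok h)%:R) = 0.
Proof.
move=> okp; elim: n acc s => [|n ih] acc s nok /=; first by rewrite (negbTE nok).
rewrite big1// => a _; rewrite big1 ?mulr0// => t _.
by rewrite ih ?mulr0//; apply: contra nok; exact: okp.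
Qed.

(** A drift criterion for leaving [ok]: [F] is a Lyapunov function losing [c] in expectation per
    step. Where [1 <= F] no drift is required, as a probability is at most 1 anyway. *)
Lemma foster (ok : pred (seq (state M * action M)))
    (F : seq (state M * action M) -> state M -> R) c :
  0 <= c <= 1 -> (forall h x, ok (rcons h x) -> ok h) ->
  (forall h s, 0 <= F h s) ->
  (forall h s, ok h -> 1 <= F h s \/
    forall a, sg h s a != 0 -> ok (rcons h (s, a)) ->
      \sum_t ratr (prob s a t) * F (rcons h (s, a)) t <= F h s - c) ->
  forall n h s, ok h ->
    hexp n h s (fun h => (ok h)%:R) <= F h s + (1 - c) ^+ n.
Proof.
move=> /andP[c0 c1] okp F0 FD; elim=> [|n ih] h s okh.
  by rewrite /= okh expr0 lerDr.
have rho0 m : 0 <= (1 - c) ^+ m by rewrite exprn_ge0// subr_ge0.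
have [F1|FS] := FD h s okh.
  by rewrite (le_trans (hexp_le1 _ _ _ _))// (le_trans F1)// lerDl.
rewrite /=; apply: sched_mean_le => a a0.
have ea := sched_neq0 a0.
have [oka|noka] := boolP (ok (rcons h (s, a))); last first.
  rewrite big1 => [|t _]; first by rewrite addr_ge0.
  by rewrite (hexp_eq0 n t okp noka) mulr0.
apply: (@le_trans _ _ (\sum_t ratr (prob s a t) *
    (F (rcons h (s, a)) t + (1 - c) ^+ n))).
  by apply: ler_sum => t _; rewrite ler_wpM2l ?prob_ge0// ih.
under eq_bigr do rewrite mulrDr.
rewrite big_split/= -mulr_suml sum_prob// mul1r.
have := FS a a0 oka.
(* The induction closes because [F - c + (1 - c)^n <= F + (1 - c)^n.+1] amounts to this
   inequality. *)
have : c * (1 - c) ^+ n <= c.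
  by rewrite -[leRHS]mulr1 ler_wpM2l// exprn_ile1 ?subr_ge0// gerBl.
rewrite exprS; set S := \sum_t _; set r := _ ^+ n.
by move=> *; lra.
Qed.

Definition hwgt (h : seq (state M * action M)) : int :=
  \sum_(x <- h) wgt x.1 x.2.

Lemma hwgt_rcons h x : hwgt (rcons h x) = hwgt h + wgt x.1 x.2.
Proof. by rewrite /hwgt -cats1 big_cat big_seq1. Qed.

Lemma pwgtE (rho : ipath M) n : pwgt rho n = hwgt (mkseq rho n).
Proof.
rewrite /pwgt /hwgt big_map.
by rewrite -(big_mkord xpredT (fun i => wgt (rho i).1 (rho i).2)) /index_iota subn0.
Qed.

(** The weight plus [H], minus [g0] per step, is a submartingale, and [H <= C] removes the final
    value of [H]. The affine form leaves room to choose a nonnegative integrand. *)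
Lemma hexp_hwgt_le (H : state M -> R) (g0 C al be : R) : 0 <= be ->
  (forall s, H s <= C) ->
  (forall h s a, sg h s a != 0 ->
     g0 + H s <= (wgt s a)%:~R + \sum_t ratr (prob s a t) * H t) ->
  forall n h s, hexp n h s (fun h => al - be * (hwgt h)%:~R) <=
    al - be * ((hwgt h)%:~R + n%:R * g0 + H s - C).
Proof.
move=> be0 HC HD; elim=> [|n ih] h s /=.
  by rewrite mul0r addr0 lerB// ler_wpM2l// -addrA gerDl subr_le0.
rewrite /=; apply: sched_mean_le => a a0.
have ea := sched_neq0 a0.
apply: (@le_trans _ _ (\sum_t ratr (prob s a t) *
    ((al - be * ((hwgt h)%:~R + (wgt s a)%:~R + n%:R * g0 - C)) - be * H t))).
  apply: ler_sum => t _; rewrite ler_wpM2l ?prob_ge0// (le_trans (ih _ _))//.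
  by rewrite hwgt_rcons/= intrD; lra.
under eq_bigr do rewrite mulrBr mulrCA.
rewrite sumrB -mulr_suml -mulr_sumr sum_prob// mul1r.
have := ler_wpM2l be0 (HD _ _ _ a0).
rewrite -natr1; set S := \sum_t _ => h1; lra.
Qed.

End finite_horizon.

(** * End components *)

Section end_components.
Variable M : mdp.
Implicit Types (s t : state M) (a : action M) (T : {set state M})
  (A : state M -> {set action M}).

Lemma sub_edgeP T A s t :
  reflect [/\ s \in T & exists2 a, a \in A s & 0 < prob s a t]
    (sub_edge T A s t).
Proof.
apply: (iffP andP) => [[sT /existsP[a /andP[aA p]]]|[sT [a aA p]]]; split => //.
  by exists a.
by apply/existsP; exists a; rewrite aA.
Qed.

(* The end component is the set of states reachable from a state that reaches
   as few states as possible. *)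
Lemma end_component_exists T A : sub_mdp T A ->
  exists2 T' : {set state M}, T' \subset T & end_component T' A.
Proof.
move=> [T0 TA].
have [s0 s0T] := finset.set0Pn _ T0.
pose reach s : {set state M} := [set t | connect (sub_edge T A) s t]%SET.
have reachT s : s \in T -> reach s \subset T.
  move=> sT; apply/fintype.subsetP => t; rewrite inE => /connectP[p].
  elim: p s sT => [|x p ih] s sT /=; first by move=> _ ->.
  move=> /andP[/sub_edgeP[_ [a aA p0]] xp]; apply: ih xp.
  by have [_ _] := TA _ sT; apply; [exact: aA|].
pose s := [arg min_(s < s0 in T) #|reach s|].
have [sT smin] : s \in T /\ forall t, t \in T -> (#|reach s| <= #|reach t|)%N.
  by rewrite /s; case: arg_minnP.
have reachS t : t \in reach s -> reach t = reach s.
  move=> ts; apply/eqP; rewrite eqEcard smin; last exact: (fintype.subsetP (reachT _ sT)).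
  rewrite andbT; apply/fintype.subsetP => x; rewrite !inE; apply: connect_trans.
  by move: ts; rewrite inE.
exists (reach s); first exact: reachT.
split; first split.
- by apply/finset.set0Pn; exists s; rewrite inE connect0.
- move=> t ts; have tT := fintype.subsetP (reachT _ sT) _ ts.
  have [An Ae Acl] := TA _ tT; split => // a aA x p.
  rewrite -(reachS _ ts) inE; apply: connect1; apply/sub_edgeP; split => //.
  by exists a.
- move=> t x ts xs; have : x \in reach t by rewrite reachS.
  rewrite inE => /connectP[p]; elim: p t ts => [|y p ih] t ts /=.
    by move=> _ ->; exact: connect0.
  move=> /andP[/sub_edgeP[tT [a aA py]] yp] e.
  have ys : y \in reach s.
    rewrite -(reachS _ ts) inE; apply: connect1; apply/sub_edgeP; split => //.
    by exists a.
  apply: connect_trans (ih _ ys yp e).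
  by apply: connect1; apply/sub_edgeP; split => //; exists a.
Qed.

Lemma sub_cycle_potential (R : numDomainType) T A (u : state M -> R) c :
  (forall s a t, s \in T -> a \in A s -> 0 < prob s a t ->
     (wgt s a)%:~R = u s - u t) ->
  Defs.sub_cycle T A c -> \sum_(x <- c) wgt x.1 x.2 = 0.
Proof.
move=> hu /andP[]; case: c => [|x c]; first by rewrite big_nil.
move=> hA cyc; apply/eqP; rewrite -(intr_eq0 R) raddf_sum/=; apply/eqP.
(* Along any path the weights telescope to a difference of potentials; closing the cycle with a
   second copy of [x] makes both ends equal. *)
suff tele y p : all (fun x => (x.1 \in T) && (x.2 \in A x.1)) (belast y p) ->
    path (fun x y => 0 < prob x.1 x.2 y.1) y p ->
    \sum_(z <- belast y p) (wgt z.1 z.2)%:~R = u y.1 - u (last y p).1.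
  have := tele x (rcons c x); rewrite belast_rcons last_rcons subrr; exact.
elim: p y => [|z p ih] y /=; first by rewrite big_nil subrr.
move=> /andP[/andP[yT yA] pA] /andP[yz zp].
by rewrite big_cons (hu _ _ z.1)// ih// subrKA.
Qed.

(** The rank of [s] is the stage at which [s] enters the least fixed point of [F], where [F X]
    collects the states whose good actions all hit [X] with positive probability. *)
Lemma rank_of_no_closed_set (good : state M -> pred (action M)) :
  (forall T A, sub_mdp T A ->
    exists s a, [/\ s \in T, a \in A s & ~~ good s a]) ->
  exists r : state M -> nat, forall s a, a \in enabled s -> good s a ->
    exists2 t, 0 < prob s a t & (r t < r s)%N.
Proof.
move=> nc.
pose F (X : {set state M}) : {set state M} :=
  [set s | [forall (a | (a \in enabled s) && good s a),
    exists t in X, 0 < prob s a t]]%SET.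
have Fm : {homo F : X Y / X \subset Y}.
  move=> X Y XY; apply/fintype.subsetP => s; rewrite !inE => /forall_inP h.
  apply/forall_inP => a ea; have /exists_inP[t tX p] := h a ea.
  by apply/exists_inP; exists t => //; exact: (fintype.subsetP XY).
have FT s : s \in fixset F.
  apply/negPn/negP => sF.
  (* If the fixed point missed a state, its complement with the good actions that stay inside it
     would be a sub-MDP without bad actions. *)
  pose T := (~: fixset F)%SET.
  pose A s : {set action M} :=
    [set a in enabled s | good s a && [forall t, (0 < prob s a t) ==> (t \in T)]]%SET.
  have [] := nc T A; last by move=> t [a [_]]; rewrite inE => /and3P[_ ->].
  split; first by apply/finset.set0Pn; exists s; rewrite inE.
  move=> t; rewrite inE -(fixsetK Fm) inE negb_forall => /existsP[a].
  rewrite negb_imply negb_exists => /andP[/andP[ea ga] /forallP na].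
  split.
  - apply/finset.set0Pn; exists a; rewrite inE ea ga/=; apply/forallP => x.
    by apply/implyP => p; have := na x; rewrite p andbT inE.
  - by apply/fintype.subsetP => b; rewrite inE => /andP[].
  - by move=> b; rewrite inE => /and3P[_ _ /forallP h] x p; exact: (implyP (h x)).
exists (fix_order F) => s a ea ga.
have k0 : (0 < fix_order F s)%N by rewrite fix_order_gt0.
have := in_iter Fm (FT s) (leqnn _).
rewrite -[X in iter X](prednK k0) iterS inE => /forall_inP/(_ a).
rewrite ea ga => /(_ isT)/exists_inP[t tX p]; exists t => //.
by rewrite (leq_ltn_trans (fix_order_small Fm tX))// ltn_predL.
Qed.

(** The rank is again a stage of a least fixed point, now of backward reachability from [T]; strong
    connectivity makes it exhaust all states. *)
Lemma rank_to_set T : strongly_connected M -> T != finset.set0 ->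
  exists r : state M -> nat, forall s, s \notin T ->
    exists a, a \in enabled s /\ exists2 t, 0 < prob s a t & (r t < r s)%N.
Proof.
move=> [_ conn] /finset.set0Pn[t0 t0T].
pose F (X : {set state M}) : {set state M} :=
  [set s | (s \in T) || [exists a in enabled s, exists t in X, 0 < prob s a t]]%SET.
have Fm : {homo F : X Y / X \subset Y}.
  move=> X Y XY; apply/fintype.subsetP => s; rewrite !inE.
  case: (s \in T) => //= /exists_inP[a ea /exists_inP[t tX p]].
  by apply/exists_inP; exists a => //; apply/exists_inP; exists t => //;
    exact: (fintype.subsetP XY).
have FT s : s \in fixset F.
  have /connectP[p] := conn s t0 (finset.in_setT _) (finset.in_setT _).
  elim: p s => [|x p ih] s /=; first by move=> _ <-; rewrite -(fixsetK Fm) inE t0T.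
  move=> /andP[/sub_edgeP[_ [a ea px]] xp] e.
  rewrite -(fixsetK Fm) inE; apply/orP; right; apply/exists_inP; exists a => //.
  by apply/exists_inP; exists x => //; exact: ih.
exists (fix_order F) => s sT.
have k0 : (0 < fix_order F s)%N by rewrite fix_order_gt0.
have := in_iter Fm (FT s) (leqnn _).
rewrite -[X in iter X](prednK k0) iterS inE (negbTE sT)/= => /exists_inP[a ea].
move=> /exists_inP[t tX p]; exists a; split => //; exists t => //.
by rewrite (leq_ltn_trans (fix_order_small Fm tX))// ltn_predL.
Qed.

Fixpoint walk T A s (c : seq (state M * action M)) t : bool :=
  if c is x :: c' then
    [&& x.1 == s, s \in T, x.2 \in A s &
      [exists y, (0 < prob s x.2 y) && walk T A y c' t]]
  else s == t.

Lemma walk_cat T A s c t c' x :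
  walk T A s c t -> walk T A t c' x -> walk T A s (c ++ c') x.
Proof.
move=> + tx; elim: c s => [|y c ih] s /=; first by move=> /eqP ->.
move=> /and4P[-> -> -> /existsP[z /andP[p zc]]] /=.
by apply/existsP; exists z; rewrite p ih.
Qed.

Lemma walk_cycle T A s c : walk T A s c s -> Defs.sub_cycle T A c.
Proof.
case: c => // x c /= /and4P[/eqP <- xT xA /existsP[y /andP[p yc]]].
(* The induction moves the pair [z] that leads into the remaining walk, while the closing pair [x]
   stays fixed. *)
suff walkP z z' : 0 < prob z.1 z.2 z' -> walk T A z' c x.1 ->
    all (fun x => (x.1 \in T) && (x.2 \in A x.1)) c &&
    path (fun x y => 0 < prob x.1 x.2 y.1) z (rcons c x).
  by have /andP[cA xc] := walkP x y p yc; rewrite /Defs.sub_cycle/= xT xA cA xc.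
elim: c z z' {yc} => [|w c ih] z z' /= pz; first by move=> /eqP <-; rewrite pz.
move=> /and4P[/eqP e zT zA /existsP[y' /andP[p' yc]]].
rewrite e zT zA pz/=; apply: (ih _ y') => //.
by rewrite e.
Qed.

Lemma walk_exists T A s t : end_component T A -> s \in T -> t \in T ->
  exists c, walk T A s c t.
Proof.
move=> [[_ TA] conn] sT tT; have /connectP[p] := conn s t sT tT.
elim: p s sT => [|y p ih] s sT /=; first by move=> _ ->; exists [::]; rewrite /=.
move=> /andP[/sub_edgeP[_ [a aA py]] yp] e.
have yT : y \in T by have [_ _] := TA _ sT; apply; [exact: aA|].
have [q qA] := ih y yT yp e.
exists ((s, a) :: q); rewrite /= eqxx sT aA/=; apply/existsP; exists y.
by rewrite py.
Qed.

(* [v s] is the opposite of the weight of a walk from [s] to a fixed state;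
   closing up such walks to cycles of weight 0 determines [wgt s a]. *)
Lemma zero_end_component_potential T A : zero_end_component T A ->
  exists v : state M -> int, forall s a t, s \in T -> a \in A s ->
    0 < prob s a t -> wgt s a = v t - v s.
Proof.
move=> [ec z]; have [[T0 TA] _] := ec.
have [s0 s0T] := finset.set0Pn _ T0.
have /choice[p pP] s : exists p, s \in T -> walk T A s p s0.
  have [sT|sT] := boolP (s \in T); last by exists [::].
  by have [p pP] := walk_exists ec sT s0T; exists p.
exists (fun s => - \sum_(x <- p s) wgt x.1 x.2) => s a t sT aA pt.
have tT : t \in T by have [_ _] := TA _ sT; apply; [exact: aA|].
have [q qs] := walk_exists ec s0T sT.
(* Two cycles through [s0] share the walk [q]: one continues with [p s], the other with [(s, a)] and
   [p t]. Subtracting their weights eliminates [q]. *)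
have /walk_cycle/z := walk_cat qs (pP _ sT).
have /walk_cycle/z : walk T A s0 (q ++ (s, a) :: p t) s0.
  apply: walk_cat qs _; rewrite /= eqxx sT aA/=; apply/existsP; exists t.
  by rewrite pt pP.
rewrite !big_cat/= big_cons/=.
move: (\sum_(i <- q) _) (\sum_(j <- p t) _) (\sum_(i <- p s) _) => x y z'.
by move=> *; lia.
Qed.

End end_components.

(** * The optimality equation *)

Lemma pos_lower_bound (R : realType) (I : finType) (Q : pred I) (f : I -> R) :
  (forall i, Q i -> 0 < f i) ->
  exists e, [/\ 0 < e, e <= 1 & forall i, Q i -> e <= f i].
Proof.
move=> f0; have [i0 Qi0|Q0] := pickP Q; last first.
  by exists 1; split => // i; rewrite Q0.
have [/= i Qi imin] := arg_minP f Qi0.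
exists (Num.min 1 (f i)); split; first by rewrite lt_min ltr01 f0.
- by rewrite ge_min lexx.
- by move=> j /imin; rewrite ge_min => ->; rewrite orbT.
Qed.

(** In a compact interval an ultrafilter converges to its cluster point. One ultrafilter thus serves
    all the sequences at once, with no successive extraction of subsequences. *)
Lemma ultra_bounded_cvg (R : realType) (T : Type) (F : set_system T)
    (f : T -> R) (C : R) :
  UltraFilter F -> (forall n, `|f n| <= C) -> exists l : R, f @ F --> l.
Proof.
move=> UF fC.
have PF : ProperFilter F by exact: ultra_proper.
have : F (f @^-1` `[- C, C]%classic).
  apply: filterS filterT => n _; rewrite /= in_itv/=.
  by have := fC n; rewrite ler_norml.
move=> /(segment_compact (fmap_proper_filter f PF)) [l [_ cl]]; exists l => N Nl.
have [//|nN] := in_ultra_setVsetC (f @^-1` N) UF.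
by have [x []] := cl (~` N) N nN Nl.
Qed.

Section optimality.
Variables (R : realType) (M : mdp).
Implicit Types (s t : state M) (a : action M).
Local Notation P s a t := (ratr (prob s a t) : R).
Local Notation w s a := ((wgt s a)%:~R : R).

Lemma state_inhabited : inhabited (state M).
Proof.
have [s _|e] := pickP (state M); first exact: inhabits s.
by have := mdp_state_neq0 M; rewrite eq_card0.
Qed.

Lemma enabled_exists s : exists a, a \in enabled s.
Proof. by have /existsP[a ea] := mdp_no_trap s; exists a; rewrite inE. Qed.

Lemma wgt_bounded : exists W : R, 0 <= W /\ forall s a, `|w s a| <= W.
Proof.
exists (\sum_(s : state M) \sum_(a : action M) `|w s a|); split.
  by apply: sumr_ge0 => s _; apply: sumr_ge0.
move=> s a; rewrite (bigD1 s)//= (bigD1 a)//= -addrA lerDl.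
by rewrite addr_ge0//; apply: sumr_ge0 => // s' _; apply: sumr_ge0.
Qed.

Lemma prob_lower_bound : exists p : R, [/\ 0 < p, p <= 1 &
  forall s a t, 0 < prob s a t -> p <= P s a t].
Proof.
have [|p [p0 p1 hp]] := @pos_lower_bound R _
    (fun x : state M * action M * state M => 0 < prob x.1.1 x.1.2 x.2)
    (fun x => P x.1.1 x.1.2 x.2); first by move=> x; rewrite ltr0q.
by exists p; split => // s a t; exact: hp (s, a, t).
Qed.

Lemma mean_ge s a (f : state M -> R) b : a \in enabled s ->
  (forall t, b <= f t) -> b <= \sum_t P s a t * f t.
Proof.
move=> ea bf; rewrite -[leLHS]mul1r -(sum_prob R ea) mulr_suml.
by apply: ler_sum => t _; rewrite ler_wpM2l// ?ler0q ?mdp_prob_ge0.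
Qed.

Lemma le_mean s a (f g : state M -> R) : (forall t, f t <= g t) ->
  \sum_t P s a t * f t <= \sum_t P s a t * g t.
Proof.
by move=> fg; apply: ler_sum => t _; rewrite ler_wpM2l// ?ler0q ?mdp_prob_ge0.
Qed.

Lemma mean_le s a (f : state M -> R) b : a \in enabled s ->
  (forall t, f t <= b) -> \sum_t P s a t * f t <= b.
Proof.
move=> ea fb; rewrite -[leRHS]mul1r -(sum_prob R ea) mulr_suml.
by apply: ler_sum => t _; rewrite ler_wpM2l// ?ler0q ?mdp_prob_ge0.
Qed.

(* The value function is the least supersolution of the Bellman equation, as
   in the Knaster-Tarski theorem. *)
Lemma discounted_value (la : R) : 0 <= la < 1 ->
  exists v : state M -> R,
    (forall s a, a \in enabled s -> w s a + la * (\sum_t P s a t * v t) <= v s) /\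
    (forall s, exists2 a, a \in enabled s &
       v s = w s a + la * (\sum_t P s a t * v t)).
Proof.
move=> /andP[la0 la1].
have [W [W0 wW]] := wgt_bounded; have [s0] := state_inhabited.
pose super (u : state M -> R) := forall s a, a \in enabled s ->
  w s a + la * (\sum_t P s a t * u t) <= u s.
have la1' : 0 < 1 - la by rewrite subr_gt0.
have superW : super (fun=> W / (1 - la)).
  move=> s a ea; rewrite -mulr_suml sum_prob// mul1r.
  have := wW s a; rewrite ler_norml => /andP[_ h].
  rewrite -lerBrDr (le_trans h)// -[X in _ <= X - _]mul1r -mulrBl.
  by rewrite mulrCA divff ?mulr1// gt_eqF.
(* At a minimiser [m] the inequality gives [u m >= - W + la * u m]. *)
have super_ge u : super u -> forall s, - (W / (1 - la)) <= u s.
  move=> su s; have [/= m _ mmin] := arg_minP u (erefl true : xpredT s0).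
  rewrite (le_trans _ (mmin s isT))//.
  have [a ea] := enabled_exists m.
  have := su m a ea; have := wW m a; rewrite ler_norml => /andP[h _] h'.
  have h2 : u m <= \sum_t P m a t * u t by apply: mean_ge => // t; exact: mmin.
  rewrite -mulNr ler_pdivrMr//.
  have := ler_wpM2l la0 h2; lra.
pose v s := inf [set u s | u in super].
have hlb s : has_lbound [set u s | u in super].
  by exists (- (W / (1 - la))) => _ [u su <-]; exact: super_ge.
have vle u s : super u -> v s <= u s.
  by move=> su; apply: ge_inf => //; exists u.
have vge s b : (forall u, super u -> b <= u s) -> b <= v s.
  move=> h; apply: lb_le_inf; first by exists (W / (1 - la)); exists (fun=> W / (1 - la)).
  by move=> _ [u su <-]; exact: h.
have sv : super v.
  move=> s a ea; apply: vge => u su; apply: le_trans (su s a ea).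
  by rewrite lerD2l ler_wpM2l// le_mean// => t; exact: vle.
exists v; split => //.
have /choice[d dP] s : exists a, a \in enabled s /\ forall b, b \in enabled s ->
    w s b + la * (\sum_t P s b t * v t) <= w s a + la * (\sum_t P s a t * v t).
  have [a0 ea0] := enabled_exists s.
  have [/= a ea amax] := arg_maxP (fun b => w s b + la * (\sum_t P s b t * v t)) ea0.
  by exists a; split.
(* By monotonicity, the Bellman operator maps the supersolution [v] to a supersolution below [v]; as
   [v] is the least one, the two agree. *)
have sT : super (fun s => w s (d s) + la * (\sum_t P s (d s) t * v t)).
  move=> s a ea; apply: le_trans ((dP s).2 a ea).
  rewrite lerD2l ler_wpM2l// le_mean// => t; apply: sv; exact: (dP t).1.
move=> s; exists (d s); first exact: (dP s).1.
apply/le_anti; rewrite (vle _ _ sT)/= sv//; exact: (dP s).1.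
Qed.

(** Here [g = (1 - la) * v s0] and [h = v - v s0] for the discounted value [v]. The point is that
    [C] does not depend on [la]. *)
Lemma discounted_relative_value : strongly_connected M ->
  exists C : R, forall la, 2^-1 <= la < 1 -> exists (g : R) (h : state M -> R),
    [/\ `|g| <= C, forall s, `|h s| <= C,
      forall s a, a \in enabled s ->
        w s a + la * (\sum_t P s a t * h t) <= g + h s &
      forall s, exists2 a, a \in enabled s &
        g + h s = w s a + la * (\sum_t P s a t * h t)].
Proof.
move=> [_ conn].
have [W [W0 wW]] := wgt_bounded; have [s0] := state_inhabited.
have [p [p0 p1 hp]] := prob_lower_bound.
(* If [v s] exceeds the minimum of [v] by [x], a successor of [s] exceeds it by at most [f x]: its
   probability is at least [p], the discount is at least 1/2, and one [W] each comes from the weight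
   and from [(1 - la) * v]. *)
pose f x := 2 / p * (x + 2 * W).
have q1 : 1 <= 2 / p by rewrite ler_pdivlMr// mul1r (le_trans p1)// ler1n.
have q0 : 0 <= 2 / p by rewrite (le_trans ler01).
have f_ge x : 0 <= x -> x <= f x.
  move=> x0; have : 0 <= (2 / p - 1) * (x + 2 * W).
    by rewrite mulr_ge0 ?subr_ge0 ?addr_ge0 ?mulr_ge0.
  by rewrite /f; lra.
have f_mono x y : x <= y -> f x <= f y by move=> xy; rewrite ler_wpM2l// lerD2r.
pose K := iter #|state M| f 0.
have fK n : (n <= #|state M|)%N -> iter n f 0 <= K.
  have fi0 k : 0 <= iter k f 0.
    by elim: k => //= k ih; rewrite (le_trans ih)// f_ge.
  move=> nS; rewrite /K -(subnK nS); elim: (_ - n)%N => //= k ih.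
  by rewrite (le_trans ih)// f_ge.
exists (W + K) => la /andP[la2 la1].
have la0 : 0 <= la by lra.
have la01 : 0 <= la < 1 by rewrite la0.
have [v [vs ve]] := discounted_value la01.
have [/= m _ mmin] := arg_minP v (erefl true : xpredT s0).
have [/= x _ xmax] := arg_maxP v (erefl true : xpredT s0).
have mlow : - W <= (1 - la) * v m.
  have [a ea] := enabled_exists m.
  have := vs m a ea; have := wW m a; rewrite ler_norml => /andP[h _] h'.
  have h2 : v m <= \sum_t P m a t * v t by apply: mean_ge => // t; exact: mmin.
  have := ler_wpM2l la0 h2; lra.
have xup : (1 - la) * v x <= W.
  have [a ea e] := ve x.
  have := wW x a; rewrite ler_norml => /andP[_ h].
  have h2 : \sum_t P x a t * v t <= v x by apply: mean_le => // t; exact: xmax.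
  have := ler_wpM2l la0 h2; lra.
have gW s : `|(1 - la) * v s| <= W.
  have l1 : 0 <= 1 - la by lra.
  have := ler_wpM2l l1 (mmin s isT); have := ler_wpM2l l1 (xmax s isT).
  rewrite ler_norml => *; lra.
have edge s a t : a \in enabled s -> 0 < prob s a t -> v t - v m <= f (v s - v m).
  move=> ea pt.
  have : P s a t * (v t - v m) <= \sum_t P s a t * (v t - v m).
    rewrite (bigD1 t)//= lerDl sumr_ge0// => i _.
    by rewrite mulr_ge0 ?prob_ge0// subr_ge0 mmin.
  under eq_bigr do rewrite mulrBr.
  rewrite sumrB -mulr_suml sum_prob// mul1r => h1.
  have h2 : p * (v t - v m) <= P s a t * (v t - v m).
    by rewrite ler_wpM2r ?subr_ge0 ?mmin// hp.
  have h3 := vs s a ea.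
  have := wW s a; rewrite ler_norml => /andP[h4 _].
  have := gW m; rewrite ler_norml => /andP[_ h5].
  have tm := mmin t isT.
  have h6 : la * (p * (v t - v m)) <= la * (\sum_t P s a t * v t - v m).
    by rewrite ler_wpM2l// (le_trans h2).
  have h7 : 2^-1 * (p * (v t - v m)) <= la * (p * (v t - v m)).
    by rewrite ler_wpM2r// mulr_ge0 ?subr_ge0// ltW.
  rewrite /f mulrC mulrA ler_pdivlMr//; lra.
have span s : v s - v m <= K.
  have /connectP[q] := conn m s (finset.in_setT _) (finset.in_setT _).
  (* A path without repetitions from the minimiser has at most as many edges as there are states, so
     [K] bounds all iterates of [f] met along it. *)
  case/shortenP => q' mq uq _ ->.
  have szq : (size q' <= #|state M|)%N.
    by have := max_card (mem (m :: q')); rewrite (card_uniqP uq) => /ltnW.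
  apply: le_trans (fK _ szq).
  elim/last_ind: q' mq {uq szq} => [|q' y ih]; first by rewrite subrr.
  rewrite rcons_path last_rcons size_rcons => /andP[mq /sub_edgeP[_ [a ea py]]].
  by apply: le_trans (edge _ _ _ ea py) _; rewrite /= f_mono// ih.
have K0 : 0 <= K by have := span m; rewrite subrr.
exists ((1 - la) * v s0), (fun s => v s - v s0); split.
- by rewrite (le_trans (gW _))// lerDl.
- move=> s; rewrite ler_norml.
  have := mmin s isT; have := mmin s0 isT; have := span s; have := span s0; lra.
- move=> s a ea; have := vs s a ea.
  under [X in _ -> _ + _ * X <= _]eq_bigr do rewrite mulrBr.
  rewrite sumrB -mulr_suml sum_prob// mul1r; lra.
- move=> s; have [a ea e] := ve s; exists a => //.
  under [X in _ = _ + _ * X]eq_bigr do rewrite mulrBr.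
  rewrite sumrB -mulr_suml sum_prob// mul1r; lra.
Qed.

Lemma optimality_equation : strongly_connected M ->
  exists (g : R) (h : state M -> R),
    (forall s a, a \in enabled s -> w s a + \sum_t P s a t * h t <= g + h s) /\
    (forall s, exists2 a, a \in enabled s &
        g + h s = w s a + \sum_t P s a t * h t).
Proof.
move=> /discounted_relative_value[C HC].
(* The offset 2 puts [la 0] at 1/2, as the uniform bound requires. *)
pose la (n : nat) : R := 1 - n.+2%:R^-1.
have la01 n : 2^-1 <= la n < 1.
  rewrite /la ltrBlDr ltrDl invr_gt0 ltr0n andbT lerBrDr.
  have : n.+2%:R^-1 <= 2^-1 :> R by rewrite lef_pV2 ?posrE ?ltr0n// ler_nat.
  by move: (n.+2%:R^-1) => x; lra.
have /choice[g /choice[h gh]] n := HC _ (la01 n).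
have [F [UF Foo]] := @ultraFilterLemma nat \oo _.
have PF : ProperFilter F by exact: ultra_proper.
have lacvg : la @ F --> (1 : R).
  apply: cvg_trans (_ : la @ \oo --> (1 : R)); first exact: cvg_app.
  rewrite -[X in _ --> X]subr0; apply: cvgB; first exact: cvg_cst.
  rewrite (cvg_shiftS (fun n => n.+1%:R^-1 : R)).
  exact: cvg_harmonic.
have [g' gcvg] : exists l : R, g @ F --> l.
  by apply: (ultra_bounded_cvg (C := C)) => // n; have [] := gh n.
have /choice[h' hcvg] s : exists l : R, h ^~ s @ F --> l.
  by apply: (ultra_bounded_cvg (C := C)) => // n; have [] := gh n.
have ecvg s a : (fun n => g n + h n s - (w s a + la n * (\sum_t P s a t * h n t))) @ F
    --> g' + h' s - (w s a + \sum_t P s a t * h' t).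
  apply: cvgB; first by apply: cvgD.
  apply: cvgD; first exact: cvg_cst.
  rewrite -[X in _ --> X]mul1r; apply: cvgM => //.
  apply: cvg_big => [|t _]; first exact: add_continuous.
  by apply: cvgM => //; exact: cvg_cst.
have lim_ge s a : a \in enabled s -> w s a + \sum_t P s a t * h' t <= g' + h' s.
  move=> ea; rewrite -subr_ge0; apply: cvgr_to_ge (ecvg s a) _.
  by apply: nearW => n; rewrite subr_ge0; have [_ _ + _] := gh n; apply.
exists g', h'; split => //.
(* The maximising action may vary with [n]. If no action were optimal in the limit, all of the
   finitely many inequalities would be strict for a common [n], where some action attains
   equality. *)
- move=> s; apply: contrapT => ne.
  have : \forall n \near F, forall a, a \in enabled s ->
      0 < g n + h n s - (w s a + la n * (\sum_t P s a t * h n t)).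
    apply: filter_forall => a.
    have [ea|nea] := boolP (a \in enabled s); last by apply: nearW.
    have lt : 0 < g' + h' s - (w s a + \sum_t P s a t * h' t).
      rewrite lt_neqAle eq_sym subr_eq0 subr_ge0 lim_ge// andbT.
      by apply/negP => /eqP e; apply: ne; exists a.
    by apply: filterS (cvgr_gt _ (ecvg s a) _ lt) => n.
  move=> /filter_ex[n hn].
  have [_ _ _ /(_ s)[a ea e]] := gh n.
  by have := hn a ea; rewrite e subrr ltxx.
Qed.
End optimality.

(** * Mean payoff and limit inferior of the weight *)

Lemma le_limn_einf (R : realType) (u v : nat -> \bar R) :
  (forall n, (u n <= v n)%E) -> (limn_einf u <= limn_einf v)%E.
Proof.
move=> uv; rewrite !limn_einf_lim.
apply: lee_lim; [exact/is_cvg_einfs|exact/is_cvg_einfs|].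
apply: nearW => n; apply: le_ereal_inf_tmp => _ [m /= nm <-].
by apply: le_trans (uv m); apply: ereal_inf_lbound; exists m.
Qed.

Section payoff.
Variables (R : realType) (M : mdp).
Implicit Types (rho : ipath M) (n : nat).

Lemma measurable_mean_payoff : measurable_fun setT (@mean_payoff R M).
Proof.
apply: measurable_fun_limn_esup => n.
under eq_fun do rewrite pwgtE.
exact: (@measurable_fun_mkseq _ _ _ n (fun h => ((hwgt h)%:~R / n%:R)%:E)).
Qed.

Lemma measurable_liminf_wgt : measurable_fun setT (@liminf_wgt R M).
Proof.
apply: measurableT_comp; first exact: oppe_measurable.
apply: measurable_fun_limn_esup => n.
under eq_fun do rewrite pwgtE.
exact: (@measurable_fun_mkseq _ _ _ n (fun h => (- ((hwgt h)%:~R)%:E)%E)).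
Qed.

Lemma measurable_bounded_below :
  measurable [set rho : ipath M | bounded_below R rho].
Proof.
rewrite (_ : [set _ | _] =
    \bigcup_(z in [set: int]) (@liminf_wgt R M @^-1` [set (z%:~R)%:E])); last first.
  by apply/seteqP; split => rho [z] => [e|_ e]; exists z.
apply: countable_bigcupT_measurable => [|z]; first exact: countableP.
rewrite -[X in measurable X]setTI.
by apply: measurable_liminf_wgt => //; exact: emeasurable_set1.
Qed.

Lemma not_neg_divergent_lower_bound rho : ~ neg_divergent R rho ->
  exists K : nat, forall n, - K%:Z <= pwgt rho n.
Proof.
move=> nd; pose u n := ((pwgt rho n)%:~R : R)%:E.
have [m um] : exists m, einfs u m <> -oo%E.
  apply: contrapT => ne; apply: nd; rewrite /neg_divergent /liminf_wgt limn_einf_lim.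
  rewrite (_ : einfs _ = cst -oo%E) ?lim_cst//; apply/funext => m.
  by apply: contrapT => e; apply: ne; exists m.
have [r ur] : exists r : R, forall n, (m <= n)%N -> r <= (pwgt rho n)%:~R.
  have lb n : (m <= n)%N -> (einfs u m <= u n)%E.
    by move=> mn; apply: ereal_inf_lbound; exists n.
  case E : (einfs u m) um lb => [r| |] // _ lb.
    by exists r => n /lb; rewrite lee_fin.
  by have := lb m (leqnn _).
have [k rk] : exists k : nat, - k%:R <= r.
  exists (Num.bound `|r|); rewrite lerNl ltW//.
  by apply: le_lt_trans (archi_boundP (normr_ge0 r)); rewrite -normrN ler_norm.
(* The tail from [m] on is above [- k]; the absolute values absorb the finitely many earlier
   prefixes. *)
exists (k + \sum_(i < m) `|pwgt rho i|)%N => n.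
have [mn|nm] := leqP m n.
  have : (- (k%:Z))%:~R <= (pwgt rho n)%:~R :> R.
    by apply: le_trans (ur n mn); rewrite mulrNz.
  by rewrite ler_int; lia.
by rewrite (bigD1 (Ordinal nm))//=; lia.
Qed.

(** A bounded integer sequence has as its limit inferior the largest integer that is eventually a
    lower bound. Shifting by [K] turns the candidates into naturals at most [2 K]. *)
Lemma eventually_bounded_below rho (K m : nat) :
  (forall n, (m <= n)%N -> `|pwgt rho n| <= K%:Z) -> bounded_below R rho.
Proof.
move=> hK.
pose Q k := `[< exists N, forall n, (N <= n)%N -> k%:Z - K%:Z <= pwgt rho n >].
have Q0 : exists k, Q k.
  by exists 0%N; apply/asboolP; exists m => n /hK; lia.
have Qb k : Q k -> (k <= K + K)%N.
  move=> /asboolP[N hN]; have := hN (maxn N m) (leq_maxl _ _).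
  by have := hK (maxn N m) (leq_maxr _ _); lia.
have [k /asboolP[N hN] kmax] := ex_maxnP Q0 Qb.
exists (k%:Z - K%:Z); rewrite /liminf_wgt limn_einf_lim.
apply/le_anti/andP; split.
  apply: lime_le; first exact: is_cvg_einfs.
  apply: nearW => n.
  (* By maximality [k + 1] fails as an eventual bound, so values at most [k - K] recur beyond every
     [n]. *)
  have [p np hp] : exists2 p, (n <= p)%N & pwgt rho p <= k%:Z - K%:Z.
    apply: contrapT => ne; have := kmax k.+1; rewrite ltnn => /(_ _)/notF; apply.
    apply/asboolP; exists n => p np; rewrite leNgt; apply/negP => lt.
    by apply: ne; exists p => //; lia.
  apply: le_trans (ereal_inf_lbound _ : (_ <= ((pwgt rho p)%:~R)%:E)%E) _.
    by exists p.
  by rewrite lee_fin ler_int.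
apply: lime_ge; first exact: is_cvg_einfs.
exists N => // n /= Nn; apply: le_ereal_inf_tmp => _ [p /= np <-].
by rewrite lee_fin ler_int hN// (leq_trans Nn).
Qed.

End payoff.

(** * Memoryless schedulers and the gain *)

Definition det_sched (R : realType) (M : mdp) (d : state M -> action M)
    (dP : forall s, d s \in enabled s) : scheduler R M.
Proof.
exists (fun _ s a => (a == d s)%:R) => [h s a|h s|h s a].
- exact: ler0n.
- by rewrite (bigD1 (d s))//= eqxx big1 ?addr0// => a /negbTE ->.
- by case: eqP => // ->; rewrite dP.
Defined.

Section gain.
Variables (R : realType) (M : mdp).
Local Notation P s a t := (ratr (prob s a t) : R).
Local Notation w s a := ((wgt s a)%:~R : R).

(** Fatou's lemma is applied to the nonnegative functions [W - pwgt rho n / n]: the sign turns the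
    limsup of the mean payoff into a liminf, and [hexp_hwgt_le] bounds the expectations. *)
Lemma expected_MP_ge (sg : scheduler R M) (g : R) (H : state M -> R) s :
  (forall h s a, sg h s a != 0 -> g + H s <= w s a + \sum_t P s a t * H t) ->
  (g%:E <= expected_MP sg s)%E.
Proof.
move=> gH.
have [W [W0 wW]] := wgt_bounded R M.
pose C := \sum_t `|H t|.
have HC t : H t <= C.
  by rewrite (le_trans (ler_norm _))// /C (bigD1 t)//= lerDl sumr_ge0.
have hW (h : seq (state M * action M)) : `|(hwgt h)%:~R| <= W * (size h)%:R :> R.
  elim: h => [|x h ih]; first by rewrite /hwgt big_nil normr0 mulr0.
  rewrite /hwgt big_cons -/(hwgt h) intrD/= -natr1 mulrDr mulr1 [leRHS]addrC.
  rewrite (le_trans (ler_normD _ _))//.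
  exact: lerD (wW x.1 x.2) ih.
have W_leh n (h : seq (state M * action M)) : size h = n -> `|(hwgt h)%:~R / n%:R| <= W.
  (* For [n = 0] the quotient is 0 by the convention for the inverse of 0. *)
  case: n => [|n] sh; first by rewrite invr0 mulr0 normr0.
  rewrite normrM normfV ler_pdivrMr ?normr_gt0 ?pnatr_eq0//.
  by rewrite [X in _ <= _ * X]ger0_norm// -sh.
have W_le n (rho : ipath M) : `|(pwgt rho n)%:~R / n%:R| <= W.
  by rewrite pwgtE W_leh// size_mkseq.
pose f n (rho : ipath M) : \bar R := (W%:E + - ((pwgt rho n)%:~R / n%:R)%:E)%E.
have f0 n rho : [set: ipath M] rho -> (0 <= f n rho)%E.
  move=> _; rewrite /f -EFinB lee_fin subr_ge0.
  by have := W_le n rho; rewrite ler_norml => /andP[].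
have fE n rho : f n rho = (W - n%:R^-1 * (hwgt (mkseq rho n))%:~R)%:E.
  by rewrite /f -EFinB pwgtE mulrC.
have mf n : measurable_fun setT (f n).
  rewrite (funext (fE n)).
  exact: (@measurable_fun_mkseq _ _ _ n (fun h => (W - n%:R^-1 * (hwgt h)%:~R)%:E)).
have If n : (\int[path_measure sg s]_rho f n rho <=
    (W - n%:R^-1 * (n%:R * g + H s - C))%:E)%E.
  under eq_integral do rewrite fE.
  rewrite (integral_hexp sg s (g := fun h => W - n%:R^-1 * (hwgt h)%:~R)) => [|h sh].
    rewrite lee_fin; have := hexp_hwgt_le W (_ : 0 <= n%:R^-1) HC gH n [::] s.
    by rewrite /hwgt big_nil add0r; apply; rewrite invr_ge0.
  by have := W_leh n h sh; rewrite ler_norml subr_ge0 mulrC => /andP[].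
have fat := fatou (path_measure sg s) measurableT mf f0.
have einfE (rho : ipath M) : limn_einf (f ^~ rho) = (W%:E - mean_payoff R rho)%E.
  rewrite /f limn_einf_shift//; congr (_ + _)%E.
  exact: (limn_einfN (fun n => ((pwgt rho n)%:~R / n%:R)%:E)).
have limW (c : R) : limn_einf (fun=> c%:E) = c%:E.
  by have [-> _] := cvg_limn_einf_sup (cvg_cst c%:E : (fun=> c%:E) @ \oo --> c%:E).
have MPle (rho : ipath M) : (`|mean_payoff R rho| <= W%:E)%E.
  have h1 : ((- W)%:E <= - mean_payoff R rho)%E.
    rewrite /mean_payoff -limn_einfN -limW; apply: le_limn_einf => n /=.
    rewrite lee_fin lerN2.
    by have := W_le n rho; rewrite ler_norml => /andP[].
  have h2 : ((- W)%:E <= mean_payoff R rho)%E.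
    apply: (@le_trans _ _ (limn_einf (fun n => ((pwgt rho n)%:~R / n%:R)%:E))); last first.
      exact: limn_einf_sup.
    rewrite -limW; apply: le_limn_einf => n /=.
    by rewrite lee_fin; have := W_le n rho; rewrite ler_norml => /andP[].
  move: h1 h2; case: (mean_payoff R rho) => [r| |] //=.
  by rewrite !lee_fin lerN2 ler_norml => -> ->.
have iW : (path_measure sg s).-integrable setT (cst W%:E).
  exact: finite_measure_integrable_cst.
have iMP : (path_measure sg s).-integrable setT (@mean_payoff R M).
  apply: le_integrable iW => //; first exact: measurable_mean_payoff.
  by move=> rho _; rewrite (le_trans (MPle rho))//= lee_fin ler_norm.
have : (\int[path_measure sg s]_rho (W%:E - mean_payoff R rho) <= (W - g)%:E)%E.
  under eq_integral do rewrite -einfE.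
  apply: le_trans fat _.
  apply: le_trans (le_limn_einf If) _.
  suff /cvg_limn_einf_sup[-> _] :
    (fun n => (W - n%:R^-1 * (n%:R * g + H s - C))%:E) @ \oo --> (W - g)%:E by [].
  apply: cvg_EFin; first exact: nearW.
  (* Dropping the index 0 makes [n%:R^-1 * n%:R] equal to 1. *)
  rewrite -cvg_shiftS.
  rewrite (_ : (fun n => _) = (fun n => W - g + (C - H s) * harmonic n)).
    have : (fun n => W - g + (C - H s) * harmonic n) @ \oo -->
        W - g + (C - H s) * 0.
      apply: cvgD; first exact: cvg_cst.
      by apply: cvgM; [exact: cvg_cst|exact: cvg_harmonic].
    by rewrite mulr0 addr0.
  apply/funext => n /=; rewrite -[n.+1%:R * g + _ - _]addrA mulrDr mulrA.
  by rewrite mulVf ?pnatr_eq0// mul1r; ring.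
rewrite integralB//= integral_cst//= probability_setT mule1.
have := integrable_fin_num measurableT iMP.
rewrite /expected_MP; case: (\int[_]_rho _)%E => // r _.
by rewrite -EFinB !lee_fin; lra.
Qed.

Lemma potential_exists : strongly_connected M ->
  (forall s : state M, (Emax_MP R s <= 0)%E) ->
  exists u : state M -> R, (forall s, 0 <= u s) /\
    forall s a, a \in enabled s -> w s a + \sum_t P s a t * u t <= u s.
Proof.
move=> sc hMP.
have [g [h [hle heq]]] := optimality_equation R sc.
have /choice[d dP] s : exists a, a \in enabled s /\ g + h s = w s a + \sum_t P s a t * h t.
  by have [a ea e] := heq s; exists a.
have [s0] := state_inhabited M.
have g0 : g <= 0.
  rewrite -lee_fin (le_trans _ (hMP s0))//.
  apply: le_trans (ereal_sup_ubound _); last first.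
    by exists (det_sched R (fun s => (dP s).1)).
  apply: (@expected_MP_ge _ g h) => hist s a /=.
  by case: (a =P d s) => [-> _|_]; [rewrite (dP s).2|rewrite eqxx].
pose C := \sum_t `|h t|.
exists (fun s => h s + C); split.
  move=> s; rewrite /C (bigD1 s)//= addrA addr_ge0 ?sumr_ge0//.
  by have := ler_norm (- h s); rewrite normrN; lra.
move=> s a ea; under eq_bigr do rewrite mulrDr.
by rewrite big_split/= -mulr_suml sum_prob// mul1r; have := hle s a ea; lra.
Qed.

End gain.

(** * Lyapunov functions *)

Section escape.
Variables (R : realType) (M : mdp).
Implicit Types (s t : state M) (a : action M) (h : seq (state M * action M)).
Local Notation P s a t := (ratr (prob s a t) : R).
Local Notation w s a := ((wgt s a)%:~R : R).

(** For fixed [eta] the geometric term vanishes as [n] grows; only then does [eta] tend to 0, so [c]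
    may depend on [eta]. *)
Lemma negligible_geometric (mu : probability (ipath M) R)
    (A : nat -> set (ipath M)) (B : set (ipath M)) :
  (forall n, measurable (A n)) -> (forall n, B `<=` A n) ->
  (forall eta, 0 < eta -> exists2 c, 0 < c <= 1 &
     forall n, (mu (A n) <= (eta + (1 - c) ^+ n)%:E)%E) ->
  mu.-negligible B.
Proof.
move=> mA BA muA.
apply: (@negligibleS _ _ _ _ (\bigcap_n A n)); first by move=> x Bx n _; exact: BA.
have mI : measurable (\bigcap_n A n) by exact: bigcapT_measurable.
apply/(negligibleP _ mI)/le_anti; rewrite measure_ge0 andbT.
apply/lee_addgt0Pr => e e0; rewrite add0e.
have e2 : 0 < e / 2 by rewrite divr_gt0.
have [c /andP[c0 c1] hc] := muA _ e2.
have /cvgrPdist_lt/(_ _ e2)[n _ /(_ n (leqnn _))] : GRing.exp (1 - c) @ \oo --> (0 : R).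
  by apply: cvg_expr; rewrite ger0_norm ?subr_ge0// gtrBl.
rewrite sub0r normrN => hn.
apply: (@le_trans _ _ (mu (A n))).
  by apply: le_measure; rewrite ?inE//; exact: bigcap_inf.
rewrite (le_trans (hc n))// lee_fin [leRHS](splitr e) lerD2l.
by rewrite (le_trans (ler_norm _))// ltW.
Qed.

Lemma rank_lyapunov (r : state M -> nat) :
  exists (psi : state M -> R) (c : R), [/\ 0 < c, c <= 1,
    forall s, -1 <= psi s <= 0 &
    forall s a, a \in enabled s ->
      (exists2 t, 0 < prob s a t & (r t < r s)%N) ->
      \sum_t P s a t * psi t <= psi s - c].
Proof.
have [p [p0 p1 hp]] := prob_lower_bound R M.
(* With [psi = - q^r], a transition to a lower rank contributes at most
   [- p * q^(r - 1) = - 2 * q^r], a gain of [q^r]. The sum [N] of all ranks makes this gain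
   uniform. *)
pose q := p / 2.
have q0 : 0 < q by rewrite divr_gt0.
have q1 : q <= 1 by rewrite /q; lra.
pose N := (\sum_s r s)%N.
exists (fun s => - q ^+ r s), (q ^+ N); split.
- exact: exprn_gt0.
- by rewrite exprn_ile1// ltW.
- by move=> s; rewrite lerN2 oppr_le0 exprn_ile1 ?exprn_ge0// ltW.
move=> s a ea [t pt rt].
have h1 : \sum_t P s a t * (- q ^+ r t) <= P s a t * (- q ^+ r t).
  rewrite (bigD1 t)//= gerDl sumr_le0// => i _.
  by rewrite mulrN oppr_le0 mulr_ge0 ?prob_ge0// exprn_ge0// ltW.
have h2 : p * q ^+ (r s).-1 <= P s a t * q ^+ r t.
  apply: ler_pM; rewrite ?hp ?exprn_ge0 ?(ltW q0) ?(ltW p0)//.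
  by rewrite ler_wiXn2l ?(ltW q0)// -ltnS (ltn_predK rt).
have h3 : p * q ^+ (r s).-1 = 2 * q ^+ r s.
  by rewrite -{2}(ltn_predK rt) exprS mulrA /q mulrCA divff ?mulr1.
have h4 : q ^+ N <= q ^+ r s.
  by rewrite ler_wiXn2l ?(ltW q0)// /N (bigD1 s)//= leq_addr.
by move: h1 h2; rewrite mulrN h3; lra.
Qed.

Lemma reach_almost_surely (T : {set state M}) (d : state M -> action M)
    (dP : forall s, d s \in enabled s) (r : state M -> nat) s :
  (forall t, t \notin T -> exists2 x, 0 < prob t (d t) x & (r x < r t)%N) ->
  (path_measure (det_sched R dP) s).-negligible
    [set rho | forall n, (rho n).1 \notin T].
Proof.
move=> hr; have [psi [c0 [c00 c01 psi1 hpsi]]] := rank_lyapunov r.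
pose ok h := all (fun x => x.1 \notin T) h.
apply: (@negligible_geometric _ (fun n => [set rho | ok (mkseq rho n)])).
- by move=> n; exact: (@measurable_mkseq M n ok).
- by move=> n rho hrho /=; apply/allP => x /mapP[i _ ->].
(* Scaling [1 + psi] by [e] brings its initial value below [eta], at the cost of the slower rate
   [e * c0]. *)
move=> eta eta0; pose e := Num.min eta 1.
have e0 : 0 < e by rewrite lt_min eta0 ltr01.
have e1 : e <= 1 by rewrite ge_min lexx orbT.
have ee : e <= eta by rewrite ge_min lexx.
have ec0 : 0 < e * c0 <= 1 by rewrite mulr_gt0//= mulr_ile1// ltW.
exists (e * c0) => // n.
rewrite path_measure_mkseq lee_fin.
apply: (le_trans (@foster R M (det_sched R dP) ok
  (fun _ t => e * (1 + psi t)) (e * c0) _ _ _ _ n [::] s isT)).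
- by rewrite ltW//=; case/andP: ec0.
- by move=> h x; rewrite /ok all_rcons => /andP[].
- move=> h t; rewrite mulr_ge0 ?(ltW e0)//; have /andP[] := psi1 t; lra.
- move=> h t _; right => a; rewrite /ok all_rcons/=.
  case: (a =P d t) => [-> _ /andP[tT _]|_]; last by rewrite eqxx.
  under eq_bigr do rewrite mulrCA.
  rewrite -mulr_sumr -mulrBr ler_wpM2l ?(ltW e0)//.
  under eq_bigr do rewrite mulrDr mulr1.
  by rewrite big_split/= sum_prob// -addrA lerD2l hpsi//; exact: hr.
rewrite lerD2r (le_trans _ ee)// ler_piMr ?(ltW e0)//.
by have /andP[] := psi1 s; lra.
Qed.

End escape.

(** * Paths whose weight stays above a constant *)

Section lower_bound.
Variables (R : realType) (M : mdp).
Implicit Types (s t : state M) (a : action M) (h : seq (state M * action M)).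
Local Notation P s a t := (ratr (prob s a t) : R).
Local Notation w s a := ((wgt s a)%:~R : R).

Variable (u : state M -> R) (r : state M -> nat) (K : nat).
Hypothesis u_ge0 : forall s, 0 <= u s.
Hypothesis u_super : forall s a, a \in enabled s ->
  w s a + \sum_t P s a t * u t <= u s.

(** The increment of weight plus [u] in one transition. *)
Let xi s a t := w s a + u t - u s.

Hypothesis r_decr : forall s a, a \in enabled s ->
  (forall t, 0 < prob s a t -> w s a + u t - u s = 0) ->
  exists2 t, 0 < prob s a t & (r t < r s)%N.

(** All prefixes are tested, not only [h], because [foster] needs a prefix-closed condition. *)
Let ok h := all (fun i => - K%:Z <= hwgt (take i h)) (iota 0 (size h).+1).

Let ok_rcons h x : ok (rcons h x) -> ok h.
Proof.
move=> /allP okx; apply/allP => i; rewrite mem_iota add0n ltnS => /= ih.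
have := okx i; rewrite mem_iota add0n size_rcons -cats1 takel_cat//; apply.
by rewrite /= ltnS (leq_trans ih).
Qed.

Let ok_ge h : ok h -> - K%:R <= (hwgt h)%:~R :> R.
Proof.
move=> /allP/(_ (size h)); rewrite mem_iota take_size/= add0n => /(_ (ltnSn _)).
by rewrite -(ler_int R) mulrNz.
Qed.

Let y h s : R := (hwgt h)%:~R + K%:R + u s.

Let y_rcons h s a t : y (rcons h (s, a)) t = y h s + xi s a t.
Proof. by rewrite /y hwgt_rcons/= intrD /xi; ring. Qed.

Let mean_xi s a : a \in enabled s -> \sum_t P s a t * xi s a t <= 0.
Proof.
move=> ea; rewrite /xi; under eq_bigr do rewrite addrAC mulrDr.
by rewrite big_split/= -mulr_suml sum_prob// mul1r; have := u_super ea; lra.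
Qed.

(* [y] is a supermartingale with steps bounded by [b]. In the strip
   [0 <= y < L], the strictly concave correction [- (y - (L + b)) ^+ 2] makes
   the Lyapunov function decrease whenever [y] may move, and [psi] makes it
   decrease when [y] stays put. *)
Lemma lower_bound_negligible (sg : scheduler R M) s :
  (path_measure sg s).-negligible
    [set rho | forall n, - K%:Z <= pwgt rho n].
Proof.
have [psi [c0 [c00 c01 psi1 hpsi]]] := rank_lyapunov R r.
have [e0 [e00 e01 he0]] : exists e : R, [/\ 0 < e, e <= 1 &
    forall x : state M * action M * state M,
      (0 < prob x.1.1 x.1.2 x.2) && (xi x.1.1 x.1.2 x.2 != 0) ->
      e <= P x.1.1 x.1.2 x.2 * xi x.1.1 x.1.2 x.2 ^+ 2].
  apply: pos_lower_bound => x /andP[px xx].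
  by rewrite mulr_gt0 ?ltr0q// exprn_even_gt0.
pose b : R := \sum_s \sum_a \sum_t `|xi s a t|.
have hb s' a t : `|xi s' a t| <= b.
  rewrite /b (bigD1 s')//= (bigD1 a)//= (bigD1 t)//= -!addrA lerDl.
  by rewrite !addr_ge0// ?sumr_ge0// => *; rewrite ?sumr_ge0// => *; rewrite sumr_ge0.
have b0 : 0 <= b by do 3 (apply: sumr_ge0 => ? _).
apply: (@negligible_geometric _ _ _ (fun n => [set rho | ok (mkseq rho n)])).
- by move=> n; exact: (@measurable_mkseq M n ok).
- move=> n rho hrho /=; apply/allP => i; rewrite mem_iota add0n size_mkseq ltnS/=.
  move=> ni; rewrite /mkseq -map_take take_iota (minn_idPl ni).
  by have := hrho i; rewrite pwgtE.
move=> eta eta0.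
have ys0 : 0 <= y [::] s by rewrite /y /hwgt big_nil add0r addr_ge0.
(* The initial Lyapunov value is at most [(y + b + 1) / L], which must not exceed [eta]. *)
pose L := Num.max 1 ((y [::] s + b + 1) / eta).
have L1 : 1 <= L by rewrite le_max lexx.
have L0 : 0 < L by rewrite (lt_le_trans ltr01).
have Leta : (y [::] s + b + 1) / L <= eta.
  by rewrite ler_pdivrMr// mulrC -ler_pdivrMr// le_max lexx orbT.
(* If [y] may move, its second moment is at least [e0], so the quadratic term drops by at least 2.
   This pays for a rise of [psi] by at most 1 and for [c0 <= 1]. *)
pose kap := 2 / e0.
have kap0 : 0 <= kap by rewrite divr_ge0// ltW.
(* [B] bounds the size of the correction on [[- b, L + b]], the range of [y] one step after the
   strip; hence [G z t] lies between [z + b] and [z + b + 1] there. *)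
pose B := kap * (L + 2 * b) ^+ 2 + 1.
have B1 : 1 <= B by rewrite lerDr mulr_ge0// sqr_ge0.
have B0 : 0 < B by rewrite (lt_le_trans ltr01).
(* The apex [L + b] is to the right of the strip, so [phi] increases on it and a negative drift of
   [y] lowers [phi] as well. *)
pose phi (z : R) : R := - (z - (L + b)) ^+ 2.
pose G z t := z + b + 1 + B^-1 * (kap * phi z + psi t).
have BB : B^-1 * B = 1 by rewrite mulVf// gt_eqF.
have iB0 : 0 <= B^-1 by rewrite invr_ge0 ltW.
have G_ge z t : - b <= z <= L + b -> z + b <= G z t.
  move=> /andP[z1 z2].
  have h1 : (z - (L + b)) ^+ 2 <= (L + 2 * b) ^+ 2.
    by rewrite -sqrrN lerXn2r ?nnegrE; lra.
  have := ler_wpM2l kap0 h1; have /andP[h2 _] := psi1 t => h3.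
  have : - B <= kap * phi z + psi t by rewrite /phi /B; lra.
  by move=> /(ler_wpM2l iB0); rewrite mulrN BB /G; lra.
have G_le z t : G z t <= z + b + 1.
  rewrite gerDl mulr_ge0_le0//; have /andP[_] := psi1 t.
  have : kap * phi z <= 0 by rewrite mulr_ge0_le0// oppr_le0 sqr_ge0.
  by lra.
pose F h t := if ok h then if y h t < L then G (y h t) t / L else 1 else 0.
have ec : 0 < B^-1 * c0 / L <= 1.
  rewrite divr_gt0 ?mulr_gt0 ?invr_gt0//= ler_pdivrMr// mul1r.
  by rewrite (le_trans _ L1)// mulr_ile1 ?(ltW c00)// invf_le1.
exists (B^-1 * c0 / L) => // n.
have ok0 : ok [::] by rewrite /ok/= /hwgt big_nil oppr_le0.
rewrite path_measure_mkseq lee_fin.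
have okG h t : ok h -> 0 <= y h t.
  by move=> /ok_ge; rewrite /y; have := u_ge0 t; lra.
apply: (le_trans (@foster R M sg ok F (B^-1 * c0 / L) _ ok_rcons _ _ n [::] s ok0)).
- by rewrite ltW//=; case/andP: ec.
- move=> h t; rewrite /F; case: ifP => // okh; case: ifP => // yL.
  have := okG h t okh => y0; rewrite divr_ge0 ?(ltW L0)//.
  by apply: le_trans (G_ge _ _ _); lra.
- move=> h t okh; rewrite {1}/F okh; case: ifPn => [yL|]; last by left.
  right => a /sched_neq0 ea _; have y0 := okG h t okh.
  apply: (@le_trans _ _ (\sum_t' P t a t' * (G (y h t + xi t a t') t' / L))).
    (* After one step [G / L] still dominates [F]: it is nonnegative where [ok] has failed, and at
       least 1 where [y] has reached [L]. *)
    apply: le_mean => t'; rewrite /F.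
    have := hb t a t'; rewrite ler_norml => /andP[x1 x2].
    have Gy : y h t + xi t a t' + b <= G (y h t + xi t a t') t'.
      by apply: G_ge; lra.
    case: ifP => _; last by rewrite divr_ge0 ?(ltW L0)//; lra.
    rewrite y_rcons; case: ltP => // Ly.
    by rewrite ler_pdivlMr// mul1r; lra.
  rewrite /F okh yL; under eq_bigr do rewrite mulrA.
  rewrite -mulr_suml -mulrBl ler_wpM2r ?invr_ge0 ?(ltW L0)//.
  set z := y h t in yL y0 *.
  pose E1 := \sum_t' P t a t' * xi t a t'.
  pose E2 := \sum_t' P t a t' * xi t a t' ^+ 2.
  pose E3 := \sum_t' P t a t' * psi t'.
  have -> : \sum_t' P t a t' * G (z + xi t a t') t' =
      z + b + 1 + E1 + B^-1 * (kap * (phi z + 2 * (L + b - z) * E1 - E2) + E3).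
    rewrite (eq_bigr (fun t' => (z + b + 1 + B^-1 * kap * phi z) * P t a t' +
      ((1 + B^-1 * kap * 2 * (L + b - z)) * (P t a t' * xi t a t') +
      (- B^-1 * kap * (P t a t' * xi t a t' ^+ 2) + B^-1 * (P t a t' * psi t')))));
      last by move=> t' _; rewrite /G /phi; ring.
    by rewrite !big_split/= -!mulr_sumr sum_prob// -/E1 -/E2 -/E3; ring.
  have E1le : E1 <= 0 by exact: mean_xi.
  have E2ge : 0 <= E2.
    by apply: sumr_ge0 => t' _; rewrite mulr_ge0 ?prob_ge0 ?sqr_ge0.
  have h1 : B^-1 * (kap * (2 * (L + b - z) * E1)) <= 0.
    rewrite mulr_ge0_le0// mulr_ge0_le0// mulr_ge0_le0//; lra.
  suff h2 : - (kap * E2) + E3 <= psi t - c0.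
    by have := ler_wpM2l iB0 h2; rewrite /G; lra.
  (* If no transition moves [y], the rank decreases with positive probability and [psi] provides the
     drift; otherwise the second moment [E2] does. *)
  have [/forallP good|] := boolP [forall t', (0 < prob t a t') ==> (xi t a t' == 0)].
    have : E3 <= psi t - c0.
      apply: hpsi => //; apply: r_decr => // t' pt'.
      by apply/eqP; exact: (implyP (good t')).
    by have := mulr_ge0 kap0 E2ge; lra.
  rewrite negb_forall => /existsP[t']; rewrite negb_imply => bad.
  have e0E2 : e0 <= E2.
    apply: le_trans (he0 (t, a, t') bad) _.
    rewrite /E2 (bigD1 t')//= lerDl sumr_ge0// => i _.
    by rewrite mulr_ge0 ?prob_ge0 ?sqr_ge0.
  have h3 : 2 <= kap * E2.
    by rewrite /kap mulrAC ler_pdivlMr// ler_pM2l.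
  have h4 : E3 <= 0.
    by apply: mean_le => // x; have /andP[] := psi1 x.
  by have /andP[] := psi1 t; lra.
rewrite lerD2r (le_trans _ Leta)// /F ok0; case: ltP => yL.
  by rewrite ler_wpM2r ?invr_ge0 ?(ltW L0).
by rewrite ler_pdivlMr// mul1r; lra.
Qed.

End lower_bound.

(** * Bounded and divergent schedulers *)

Section assembly.
Variables (R : realType) (M : mdp).
Implicit Types (s t : state M) (rho : ipath M).

(** An action is good if all its transitions keep weight plus [u] unchanged. A sub-MDP of good
    actions contains an end component, and telescoping makes it a 0-EC. *)
Lemma no_0EC_rank (u : state M -> R) : ~ contains_0EC M ->
  exists r : state M -> nat, forall s a, a \in enabled s ->
    (forall t, 0 < prob s a t -> (wgt s a)%:~R + u t - u s = 0) ->
    exists2 t, 0 < prob s a t & (r t < r s)%N.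
Proof.
move=> no0.
pose good s (a : action M) :=
  [forall t, (0 < prob s a t) ==> ((wgt s a)%:~R + u t - u s == 0)].
have [T A TA|r hr] := @rank_of_no_closed_set M good.
  apply: contrapT => allgood; apply: no0.
  have [T' T'T ec] := end_component_exists TA.
  exists T', A; split => // c.
  apply: (@sub_cycle_potential _ R T' A u) => s a t sT' aA pt.
  have : good s a.
    apply/negPn/negP => ng; apply: allgood; exists s, a; split => //.
    exact: (fintype.subsetP T'T).
  by move=> /forallP/(_ t)/implyP/(_ pt)/eqP; lra.
exists r => s a ea g; apply: hr => //; apply/forallP => t; apply/implyP => pt.
by apply/eqP; exact: g.
Qed.

Lemma no_0EC_neg_divergent (sg : scheduler R M) : strongly_connected M ->
  (forall s : state M, (Emax_MP R s <= 0)%E) -> ~ contains_0EC M ->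
  sched_neg_divergent sg.
Proof.
move=> sc hMP no0 s.
have [u [u0 hu]] := potential_exists sc hMP.
have [r hr] := no_0EC_rank u no0.
apply: negligibleS (negligible_bigcup
  (fun K => lower_bound_negligible K u0 hu hr sg s)) => rho.
by move=> /not_neg_divergent_lower_bound[K hK]; exists K.
Qed.

Lemma step_prob_rcons (sg : scheduler R M) s h z x :
  step_prob sg s (rcons h z) x =
  ratr (prob z.1 z.2 x.1) * sg (rcons h z) x.1 x.2.
Proof. by case: h => [|y h] //=; rewrite /step_prob/= last_rcons. Qed.

(** A path breaking the condition has a prefix of probability 0; for each length these prefixes form
    a null event, and there are countably many lengths. *)
Lemma consistent_almost_surely (sg : scheduler R M) s :
  (path_measure sg s).-negligible
    (~` [set rho | forall n, sg (mkseq rho n) (rho n).1 (rho n).2 != 0 /\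
                             0 < prob (rho n).1 (rho n).2 (rho n.+1).1]).
Proof.
pose bad h := cyl_prob (step_prob sg s) [::] h == 0.
apply: (@negligibleS _ _ _ _ (\bigcup_n [set rho : ipath M | bad (mkseq rho n)])); last first.
  apply: negligible_bigcup => n.
  apply/negligibleP; first exact: (@measurable_mkseq M n bad).
  rewrite [LHS](path_measure_mkseq sg s n bad) -sum_cyl_prob_nil big1// => h _.
  by rewrite /bad; case: eqP => [->|]; rewrite ?mul0r ?mulr0.
move=> rho ncons; apply: contrapT => nbad; apply: ncons => n /=.
have kn m : step_prob sg s (mkseq rho m) (rho m) != 0.
  apply/negP => /eqP e; apply: nbad; exists m.+1 => //=.
  by rewrite /bad mkseqS cyl_prob_rcons e mulr0.
split.
  by have := kn n; apply: contraNN => /eqP e; rewrite /step_prob e mulr0.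
(* The transition out of the pair at [n] is a factor of the step probability at [n + 1]. *)
have := kn n.+1; rewrite mkseqS step_prob_rcons mulf_eq0 negb_or => /andP[+ _].
rewrite lt_neqAle mdp_prob_ge0 andbT; apply: contraNN => /eqP <-.
by rewrite rmorph0.
Qed.

(** The memoryless scheduler lowers the rank outside [T] and uses retained actions inside. Once in
    [T] it stays there, and the weight follows the bounded potential [v]. *)
Lemma zero_EC_bounded_below (T : {set state M}) A : strongly_connected M ->
  zero_end_component T A -> exists sg : scheduler R M, sched_bounded_below sg.
Proof.
move=> sc z; have [[[T0 TA] _] _] := z.
have [v hv] := zero_end_component_potential z.
have [r hr] := rank_to_set sc T0.
have /choice[d dP] s : exists a, [/\ a \in enabled s, s \in T -> a \in A s &
    s \notin T -> exists2 t, 0 < prob s a t & (r t < r s)%N].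
  have [sT|sT] := boolP (s \in T).
    have [/finset.set0Pn[a aA] /fintype.subsetP Ae _] := TA _ sT.
    by exists a; split => //; exact: Ae.
  by have [a [ea h]] := hr s sT; exists a; split => // /negP.
have de s : d s \in enabled s by have [] := dP s.
exists (det_sched R de) => s.
have hT t : t \notin T -> exists2 x, 0 < prob t (d t) x & (r x < r t)%N.
  by have [_ _] := dP t.
apply: negligibleS (negligibleU (consistent_almost_surely (det_sched R de) s)
  (reach_almost_surely R de s hT)) => rho nb.
apply: contrapT => /not_orP[/contrapT cons /existsNP[m /negP/negPn mT]].
apply: nb => /=.
have rd n : (rho n).2 = d (rho n).1.
  have [+ _] := cons n; case: ((rho n).2 =P d (rho n).1) => // /eqP/negbTE /= ->.
  by rewrite eqxx.
have inT n : (rho (m + n)%N).1 \in T.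
  elim: n => [|n ih]; first by rewrite addn0.
  have [_ _ cl] := TA _ ih; have [_ dA _] := dP (rho (m + n)%N).1.
  rewrite addnS; apply: (cl _ (dA ih)); rewrite -rd.
  by have [] := cons (m + n)%N.
have pw n : pwgt rho (m + n) = pwgt rho m + v (rho (m + n)%N).1 - v (rho m).1.
  elim: n => [|n ih]; first by rewrite addn0 addrK.
  have [_ dA _] := dP (rho (m + n)%N).1; have [_ pn] := cons (m + n)%N.
  rewrite addnS /pwgt big_ord_recr/= -/(pwgt rho (m + n)) ih.
  rewrite (hv _ _ (rho (m + n).+1).1 (inT n))//; last by rewrite rd dA.
  by ring.
have vb s' : `|v s'| <= \sum_t `|v t|.
  by rewrite (bigD1 s')//= lerDl sumr_ge0.
pose K := `|pwgt rho m| + \sum_t `|v t| + \sum_t `|v t|.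
have K0 : 0 <= K by rewrite !addr_ge0// sumr_ge0.
apply: (@eventually_bounded_below R M rho `|K|%N m) => n mn.
rewrite -(subnKC mn) pw gez0_abs// /K.
by rewrite (le_trans (ler_normB _ _))// lerD// (le_trans (ler_normD _ _))// lerD.
Qed.

End assembly.

Theorem theorem3p4 (R : realType) (M : mdp)
  (hSC : strongly_connected M)
  (hMP : forall s : state M, Emax_MP R s = 0%E) :
  (* (a) *)
  ((contains_0EC M <->
    exists (sg : scheduler R M) (s : state M),
      (0 < path_measure sg s [set rho | bounded_below R rho])%E) /\
   ((exists (sg : scheduler R M) (s : state M),
      (0 < path_measure sg s [set rho | bounded_below R rho])%E) <->
    exists sg : scheduler R M, sched_bounded_below sg)) /\
  (* (b) *)
  (~ contains_0EC M <-> forall sg : scheduler R M, sched_neg_divergent sg).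
Proof.
have mb := @measurable_bounded_below R M.
(* A path bounded from below has a finite limit inferior, so divergence almost everywhere makes
   these paths a null set. *)
have nodiv (sg : scheduler R M) (s : state M) :
    (0 < path_measure sg s [set rho | bounded_below R rho])%E ->
    ~ sched_neg_divergent sg.
  move=> + nd; rewrite (_ : path_measure _ _ _ = 0%E) ?ltxx//.
  apply/(negligibleP _ mb); apply: negligibleS (nd s) => rho [z ez] /=.
  by rewrite /neg_divergent ez.
have pos (sg : scheduler R M) : sched_bounded_below sg -> exists s,
    (0 < path_measure sg s [set rho | bounded_below R rho])%E.
  move=> bb; have [s] := state_inhabited M; exists s.
  have e : path_measure sg s (~` [set rho | bounded_below R rho]) = 0%E.
    by apply/(negligibleP _ (measurableC mb)); exact: bb s.
  rewrite lt0e measure_ge0 andbT; apply/eqP => b0.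
  by move/eqP: e; rewrite probability_setC// b0 sube0 onee_eq0.
have bdd : contains_0EC M -> exists sg : scheduler R M, sched_bounded_below sg.
  by move=> [T [A z]]; exact: zero_EC_bounded_below hSC z.
have div : ~ contains_0EC M -> forall sg : scheduler R M, sched_neg_divergent sg.
  by move=> no0 sg; apply: no_0EC_neg_divergent => // s; rewrite hMP.
have ec (sg : scheduler R M) (s : state M) :
    (0 < path_measure sg s [set rho | bounded_below R rho])%E -> contains_0EC M.
  by move=> h; apply: contrapT => /div/(_ sg); exact: nodiv h.
split; [split; split|split].
- by move=> /bdd[sg /pos h]; exists sg.
- by move=> [sg [s]]; exact: ec.
- by move=> [sg [s /ec]].
- by move=> [sg /pos h]; exists sg.
- exact: div.
- by move=> nd /bdd[sg /pos[s h]]; exact: nodiv h (nd sg).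
Qed.
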